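(* Let $I,J,M,N\subseteq\{1,\dots,n\}$ with $|I|=|J|$ and $|M|=|N|$. Then in $A=\mathcal{O}_q(M_n(k))$, $$q^{|J\cap N|}[I|J][M|N]+q^{|J\cap N|}\sum_{S\in\{>I\Vert M\}}\widetilde{\mu}_S\,[S|J][S^\natural|N]=q^{|I\cap M|}[M|N][I|J]+q^{|I\cap M|}\sum_{T\in\{<J\Vert N\}}\widetilde{\lambda}_T\,[M|T^\natural][I|T],$$ where $S^\natural=S^\natural_{I,M}$, $T^\natural=T^\natural_{J,N}$, and $$\widetilde{\mu}_S=(-\widehat{q})^{|S\setminus I|}(-q)^{-\mathcal{L}^\natural(S,I,M)}\xi_q(S\setminus I;I\setminus S),\qquad \widetilde{\lambda}_T=(-\widehat{q})^{|J\setminus T|}(-q)^{-\mathcal{L}(T,J,N)}\xi_q(J\setminus T;T\setminus J)$$ for $S\in\{>I\Vert M\}$ and $T\in\{<J\Vert N\}$.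
   Context: Let $k$ be a field, $n$ a positive integer, $q\in k^\times$, and $\widehat{q}=q-q^{-1}$. The algebra $A=\mathcal{O}_q(M_n(k))$ is the $k$-algebra with generators $X_{ij}$ ($1\le i,j\le n$) and relations: $X_{ij}X_{lj}=qX_{lj}X_{ij}$ for $i<l$; $X_{ij}X_{im}=qX_{im}X_{ij}$ for $j<m$; $X_{ij}X_{lm}=X_{lm}X_{ij}$ for $i<l$, $j>m$; $X_{ij}X_{lm}-X_{lm}X_{ij}=\widehat{q}\,X_{im}X_{lj}$ for $i<l$, $j<m$. Quantum minors: for $I=\{i_1<\cdots<i_t\}$ and $J=\{j_1<\cdots<j_t\}$, $[I|J]=\sum_{\sigma\in S_t}(-q)^{\ell(\sigma)}X_{i_1,j_{\sigma(1)}}\cdots X_{i_t,j_{\sigma(t)}}$, where $\ell(\sigma)$ is the length (number of inversions) of $\sigma$; $[\varnothing|\varnothing]=1$. For such $I,J$, $I\le J$ means $i_l\le j_l$ for all $l$; $I<J$ means $I\le J$ and $I\ne J$. For $S,T\subseteq\{1,\dots,n\}$, $\ell(S;T)=|\{(s,t)\in S\times T\mid s>t\}|$. For $d\in\mathbb{N}$, $[d]_{-q}=(-q)^{d-1}+(-q)^{d-3}+\cdots+(-q)^{-(d-1)}$. For index sets $U\ge V$ of the same cardinality $m$, write $U=\{r_1<\cdots<r_m\}$, set $d_l=|[1,r_l]\cap V|-l+1$ (which is $\ge1$) and define $\xi_q(U;V)=[d_1]_{-q}\cdots[d_m]_{-q}$, with $\xi_q(\varnothing;\varnothing)=1$. For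 $X,Y\subseteq\{1,\dots,n\}$: $\{<X\Vert Y\}=\{S\subseteq X\cup Y\mid X\cap Y\subseteq S,\ |S|=|X|,\ S<X\}$ and $\{>X\Vert Y\}=\{T\subseteq X\cup Y\mid X\cap Y\subseteq T,\ |T|=|X|,\ T>X\}$. For $X\cap Y\subseteq S\subseteq X\cup Y$, $S^\natural=S^\natural_{X,Y}=(X\cap Y)\sqcup\bigl((X\cup Y)\setminus S\bigr)$. For $S\in\{<X\Vert Y\}$ and $T\in\{>X\Vert Y\}$ (with $\natural$ taken relative to $X,Y$), $\mathcal{L}(S,X,Y)=\ell\bigl((S\setminus S^\natural)\cup(Y\setminus X);X\setminus S\bigr)-\ell\bigl((S\setminus S^\natural)\cup(Y\setminus X);S\setminus X\bigr)$, $\mathcal{L}^\natural(T,X,Y)=\ell\bigl((T^\natural\setminus T)\cup(X\setminus Y);T\setminus X\bigr)-\ell\bigl((T^\natural\setminus T)\cup(X\setminus Y);X\setminus T\bigr)$. *)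

(* Defs.v *)
From HB Require Import structures.
From mathcomp Require Import all_boot all_order perm all_algebra.
From mathcomp Require Import boolp.
From mathcomp.multinomials Require Import monalg.

Set Implicit Arguments.
Unset Strict Implicit.
Unset Printing Implicit Defensive.

Import GRing.Theory.
Local Open Scope ring_scope.
Local Open Scope quotient_scope.

(* {1, ..., n} is rendered by 'I_n, i.e. all indices are shifted down by 1. *)

Lemma mul_sandwich (R : nzRingType) (a b c d r y : R) :
  a * (c * r * d + y) * b = (a * c) * r * (d * b) + a * y * b.
Proof. by rewrite mulrDr mulrDl !mulrA. Qed.

Section FreeAlgebra.
Variables (k : fieldType) (n : nat).

Definition freealg := {malg k[{fmonom ('I_n * 'I_n)%type}]}.

Lemma freealg_scalerAr c (x y : freealg) : c *: (x * y) = x * (c *: y).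
Proof.
have comC (z : freealg) : c *: z = z * (mkmalgU mone c : freealg).
  rewrite -mul_malgC !malgM_def fgmulUg fgmulgU.
  by apply: eq_bigr => m _; rewrite mulrC mul1m mulm1.
by rewrite !comC mulrA.
Qed.

End FreeAlgebra.

(* The generators and the operations of the quotient are sealed, to keep
   unification from unfolding the quotient and the free algebra. *)
HB.lock Definition fgen (k : fieldType) (n : nat) (i j : 'I_n) : freealg k n :=
  mkmalgU (fmu (i, j)) 1.

Section QuantumMatrices.
Variables (k : fieldType) (n : nat) (q : k).
Local Notation x := (@fgen k n).

Inductive qrelator : freealg k n -> Prop :=
| qrel_col (i l j : 'I_n) of (i < l)%N :
    qrelator (x i j * x l j - q *: (x l j * x i j))
| qrel_row (i j m : 'I_n) of (j < m)%N :
    qrelator (x i j * x i m - q *: (x i m * x i j))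
| qrel_comm (i l j m : 'I_n) of (i < l)%N & (m < j)%N :
    qrelator (x i j * x l m - x l m * x i j)
| qrel_cross (i l j m : 'I_n) of (i < l)%N & (j < m)%N :
    qrelator (x i j * x l m - x l m * x i j
              - (q - q^-1) *: (x i m * x l j)).

Inductive in_qideal : freealg k n -> Prop :=
| in_qideal0 : in_qideal 0
| in_qidealD a r b y of qrelator r & in_qideal y :
    in_qideal (a * r * b + y).

Definition qideal : freealg k n -> bool := fun y => `[< in_qideal y >].

Lemma qidealP y : reflect (in_qideal y) (y \in qideal).
Proof. exact: asboolP. Qed.

Lemma in_qideal_add y z : in_qideal y -> in_qideal z -> in_qideal (y + z).
Proof.
by elim=> [|a r b {}y rP _ IH] zP; rewrite ?add0r // -addrA; constructor; auto.
Qed.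

Lemma in_qidealM a b y : in_qideal y -> in_qideal (a * y * b).
Proof.
elim=> [|c r d {}y rP _ IH]; first by rewrite mulr0 mul0r; constructor.
have -> : a * (c * r * d + y) * b = (a * c) * r * (d * b) + a * y * b.
  exact: mul_sandwich.
exact: in_qidealD.
Qed.

Lemma qideal_zmod_closed : zmod_closed qideal.
Proof.
split=> [|y z /qidealP yP /qidealP zP]; first by apply/qidealP; constructor.
apply/qidealP/in_qideal_add => //.
by rewrite -mulN1r -[_ * _]mulr1; apply: in_qidealM.
Qed.
HB.instance Definition _ :=
  GRing.isZmodClosed.Build (freealg k n) qideal qideal_zmod_closed.

Lemma qidealMl a y : y \in qideal -> a * y \in qideal.
Proof.
by move=> /qidealP yP; apply/qidealP; rewrite -[_ * _]mulr1; apply: in_qidealM.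
Qed.

Lemma qidealMr a y : y \in qideal -> y * a \in qideal.
Proof.
by move=> /qidealP yP; apply/qidealP; rewrite -[y]mul1r; apply: in_qidealM.
Qed.

Definition qequiv (y z : freealg k n) : bool := y - z \in qideal.

Lemma qequiv_is_equiv : equiv_class_of qequiv.
Proof.
split=> [y|y z|z y w]; rewrite /qequiv ?subrr ?rpred0 //.
  by rewrite -opprB rpredN.
by move=> yz zw; rewrite -[y](subrK z) -addrA rpredD.
Qed.
Canonical qequiv_equiv := EquivRelPack qequiv_is_equiv.
Canonical qequiv_encModRel := defaultEncModRel qequiv.

Definition Oq := {eq_quot qequiv}.
HB.instance Definition _ := Choice.on Oq.

Definition Oq_pi (y : freealg k n) : Oq := \pi_Oq y.

Lemma Oq_piP y z : reflect (Oq_pi y = Oq_pi z) (y - z \in qideal).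
Proof. exact: (eqmodP qequiv_equiv). Qed.

Lemma Oq_reprK (u : Oq) : Oq_pi (repr u) = u.
Proof. exact: reprK. Qed.

Lemma Oq_repr_pi y : repr (Oq_pi y) - y \in qideal.
Proof. by apply/Oq_piP; rewrite Oq_reprK. Qed.

End QuantumMatrices.

HB.lock Definition Oq_zero (k : fieldType) n (q : k) : Oq n q := Oq_pi q 0.
HB.lock Definition Oq_one (k : fieldType) n (q : k) : Oq n q := Oq_pi q 1.
HB.lock Definition Oq_opp (k : fieldType) n (q : k) (u : Oq n q) : Oq n q :=
  Oq_pi q (- repr u).
HB.lock Definition Oq_add (k : fieldType) n (q : k) (u v : Oq n q) : Oq n q :=
  Oq_pi q (repr u + repr v).
HB.lock Definition Oq_mul (k : fieldType) n (q : k) (u v : Oq n q) : Oq n q :=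
  Oq_pi q (repr u * repr v).
HB.lock Definition Oq_scale (k : fieldType) n (q : k) (c : k) (u : Oq n q) :
  Oq n q := Oq_pi q (c *: repr u).
HB.lock Definition X (k : fieldType) n (q : k) (i j : 'I_n) : Oq n q :=
  Oq_pi q (fgen k i j).

Section OqTheory.
Variables (k : fieldType) (n : nat) (q : k).
Local Notation x := (@fgen k n).
Local Notation Oq := (Oq n q).
Local Notation Oq_pi := (@Oq_pi k n q).
Local Notation Oq_one := (@Oq_one k n q).
Local Notation Oq_zero := (@Oq_zero k n q).
Local Notation Oq_add := (@Oq_add k n q).
Local Notation Oq_opp := (@Oq_opp k n q).
Local Notation Oq_mul := (@Oq_mul k n q).
Local Notation Oq_scale := (@Oq_scale k n q).
Local Notation qrelator := (@qrelator k n q).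
Local Notation qideal := (@qideal k n q).
Local Notation in_qideal := (@in_qideal k n q).
Local Notation X := (@X k n q).

Lemma Oq_pi_opp y : Oq_opp (Oq_pi y) = Oq_pi (- y).
Proof.
rewrite Oq_opp.unlock; apply/Oq_piP.
by rewrite -opprD rpredN Oq_repr_pi.
Qed.

Lemma Oq_pi_add y z : Oq_add (Oq_pi y) (Oq_pi z) = Oq_pi (y + z).
Proof.
rewrite Oq_add.unlock; apply/Oq_piP.
by rewrite opprD addrACA rpredD ?Oq_repr_pi.
Qed.

Lemma Oq_pi_mul y z : Oq_mul (Oq_pi y) (Oq_pi z) = Oq_pi (y * z).
Proof.
rewrite Oq_mul.unlock; apply/Oq_piP.
have -> : forall a b : freealg k n,
    a * b - y * z = a * (b - z) + (a - y) * z.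
  by move=> a b; rewrite mulrBr mulrBl addrA addrNK.
by apply: rpredD; [apply: qidealMl | apply: qidealMr]; apply: Oq_repr_pi.
Qed.

Lemma Oq_pi_scale c y : Oq_scale c (Oq_pi y) = Oq_pi (c *: y).
Proof.
rewrite Oq_scale.unlock; apply/Oq_piP; rewrite -scalerBr -mulr_algl.
by apply: qidealMl; apply: Oq_repr_pi.
Qed.

Lemma Oq_addA : associative Oq_add.
Proof.
move=> u v w; rewrite -(Oq_reprK u) -(Oq_reprK v) -(Oq_reprK w).
by rewrite !Oq_pi_add addrA.
Qed.

Lemma Oq_addC : commutative Oq_add.
Proof.
move=> u v; rewrite -(Oq_reprK u) -(Oq_reprK v).
by rewrite !Oq_pi_add addrC.
Qed.

Lemma Oq_add0 : left_id Oq_zero Oq_add.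
Proof.
by move=> u; rewrite Oq_zero.unlock -(Oq_reprK u) Oq_pi_add add0r.
Qed.

Lemma Oq_addN : left_inverse Oq_zero Oq_opp Oq_add.
Proof.
move=> u; rewrite Oq_zero.unlock -(Oq_reprK u).
by rewrite Oq_pi_opp Oq_pi_add addNr.
Qed.

HB.instance Definition _ :=
  GRing.isZmodule.Build Oq Oq_addA Oq_addC Oq_add0 Oq_addN.

Lemma Oq_mulA : associative Oq_mul.
Proof.
move=> u v w; rewrite -(Oq_reprK u) -(Oq_reprK v) -(Oq_reprK w).
by rewrite !Oq_pi_mul mulrA.
Qed.

Lemma Oq_mul1 : left_id Oq_one Oq_mul.
Proof.
by move=> u; rewrite Oq_one.unlock -(Oq_reprK u) Oq_pi_mul mul1r.
Qed.

Lemma Oq_mulr1 : right_id Oq_one Oq_mul.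
Proof.
by move=> u; rewrite Oq_one.unlock -(Oq_reprK u) Oq_pi_mul mulr1.
Qed.

Lemma Oq_mulDl : left_distributive Oq_mul Oq_add.
Proof.
move=> u v w; rewrite -(Oq_reprK u) -(Oq_reprK v) -(Oq_reprK w).
by rewrite Oq_pi_add !Oq_pi_mul Oq_pi_add mulrDl.
Qed.

Lemma Oq_mulDr : right_distributive Oq_mul Oq_add.
Proof.
move=> u v w; rewrite -(Oq_reprK u) -(Oq_reprK v) -(Oq_reprK w).
by rewrite Oq_pi_add !Oq_pi_mul Oq_pi_add mulrDr.
Qed.

Lemma in_qideal_mcoeff1 y : in_qideal y -> mcoeff mone y = 0.
Proof.
have x1 i j : mcoeff mone (x i j) = 0.
  rewrite fgen.unlock mcoeffU; case: eqP => // /(congr1 (@fmonom_val _)).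
  by rewrite fmU fm1.
have cM (a b : freealg k n) :
    mcoeff mone (a * b) = mcoeff mone a * mcoeff mone b.
  exact: (rmorphM (mcoeff mone)).
elim=> [|a r b {}y rP _ yE]; first exact: mcoeff0.
suff rE : mcoeff mone r = 0 by rewrite mcoeffD !cM rE mulr0 mul0r yE addr0.
have x2 i j l m : mcoeff mone (x i j * x l m) = 0 by rewrite cM x1 mul0r.
have cB (y1 y2 : freealg k n) : mcoeff mone y1 = 0 -> mcoeff mone y2 = 0 ->
    mcoeff mone (y1 - y2) = 0.
  by rewrite mcoeffB => -> ->; rewrite subr0.
have cZ c (y1 : freealg k n) : mcoeff mone y1 = 0 -> mcoeff mone (c *: y1) = 0.
  by rewrite mcoeffZ => ->; rewrite mulr0.
case: rP => [i l j _|i j m _|i l j m _ _|i l j m _ _].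
- exact: cB (x2 _ _ _ _) (cZ _ _ (x2 _ _ _ _)).
- exact: cB (x2 _ _ _ _) (cZ _ _ (x2 _ _ _ _)).
- exact: cB (x2 _ _ _ _) (x2 _ _ _ _).
- exact: cB (cB _ _ (x2 _ _ _ _) (x2 _ _ _ _)) (cZ _ _ (x2 _ _ _ _)).
Qed.

Lemma Oq_oner_neq0 : Oq_one != Oq_zero.
Proof.
apply/eqP; rewrite Oq_one.unlock Oq_zero.unlock => /Oq_piP; rewrite subr0.
move=> /qidealP /in_qideal_mcoeff1.
by rewrite mcoeff1 eqxx => /eqP; rewrite oner_eq0.
Qed.

HB.instance Definition _ := GRing.Zmodule_isNzRing.Build Oq
  Oq_mulA Oq_mul1 Oq_mulr1 Oq_mulDl Oq_mulDr Oq_oner_neq0.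

Lemma Oq_scaleA a b u : Oq_scale a (Oq_scale b u) = Oq_scale (a * b) u.
Proof. by rewrite -(Oq_reprK u) !Oq_pi_scale scalerA. Qed.

Lemma Oq_scale1 : left_id 1 Oq_scale.
Proof. by move=> u; rewrite -(Oq_reprK u) Oq_pi_scale scale1r. Qed.

Lemma Oq_scaleDr : right_distributive Oq_scale Oq_add.
Proof.
move=> a u v; rewrite -(Oq_reprK u) -(Oq_reprK v).
by rewrite Oq_pi_add !Oq_pi_scale Oq_pi_add scalerDr.
Qed.

Lemma Oq_scaleDl u a b :
  Oq_scale (a + b) u = Oq_add (Oq_scale a u) (Oq_scale b u).
Proof. by rewrite -(Oq_reprK u) !Oq_pi_scale Oq_pi_add scalerDl. Qed.

HB.instance Definition _ := GRing.Zmodule_isLmodule.Build k Oq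
  Oq_scaleA Oq_scale1 Oq_scaleDr Oq_scaleDl.

Lemma Oq_scalerAl a u v : Oq_scale a (Oq_mul u v) = Oq_mul (Oq_scale a u) v.
Proof.
rewrite -(Oq_reprK u) -(Oq_reprK v).
by rewrite Oq_pi_scale !Oq_pi_mul Oq_pi_scale scalerAl.
Qed.
HB.instance Definition _ := GRing.Lmodule_isLalgebra.Build k Oq Oq_scalerAl.

Lemma Oq_scalerAr a u v : Oq_scale a (Oq_mul u v) = Oq_mul u (Oq_scale a v).
Proof.
rewrite -(Oq_reprK u) -(Oq_reprK v).
by rewrite Oq_pi_scale !Oq_pi_mul Oq_pi_scale freealg_scalerAr.
Qed.
HB.instance Definition _ := GRing.Lalgebra_isAlgebra.Build k Oq Oq_scalerAr.

Lemma Oq_piB y z : Oq_pi y - Oq_pi z = Oq_pi (y - z).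
Proof.
by rewrite -[LHS]/(Oq_add (Oq_pi y) (Oq_opp (Oq_pi z))) Oq_pi_opp Oq_pi_add.
Qed.

Lemma Oq_piZ c y : c *: Oq_pi y = Oq_pi (c *: y).
Proof. exact: Oq_pi_scale. Qed.

Lemma XM i j l m : X i j * X l m = Oq_pi (x i j * x l m).
Proof. by rewrite !X.unlock; exact: Oq_pi_mul. Qed.

Lemma qrelator_pi (y z : freealg k n) : qrelator (y - z) -> Oq_pi y = Oq_pi z.
Proof.
move=> yzP; apply/Oq_piP/qidealP.
by have := in_qidealD 1 1 yzP (@in_qideal0 k n q); rewrite mul1r mulr1 addr0.
Qed.

Lemma X_col (i l j : 'I_n) : (i < l)%N ->
  X i j * X l j = q *: (X l j * X i j).
Proof. by move=> il; rewrite !XM Oq_piZ; exact/qrelator_pi/qrel_col. Qed.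

Lemma X_row (i j m : 'I_n) : (j < m)%N ->
  X i j * X i m = q *: (X i m * X i j).
Proof. by move=> jm; rewrite !XM Oq_piZ; exact/qrelator_pi/qrel_row. Qed.

Lemma X_comm (i l j m : 'I_n) : (i < l)%N -> (m < j)%N ->
  X i j * X l m = X l m * X i j.
Proof. by move=> il mj; rewrite !XM; exact/qrelator_pi/qrel_comm. Qed.

Lemma X_cross (i l j m : 'I_n) : (i < l)%N -> (j < m)%N ->
  X i j * X l m - X l m * X i j = (q - q^-1) *: (X i m * X l j).
Proof.
move=> il jm; rewrite !XM Oq_piZ Oq_piB.
exact/qrelator_pi/qrel_cross.
Qed.

(* For A : {set 'I_n}, enum A lists A increasingly and enum_val l is its
   (l+1)-st smallest element.  The default value of nth is irrelevant when
   #|I| = #|J|, which is the only case of interest. *)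

Definition perm_length t (s : 'S_t) : nat :=
  #|[set p : 'I_t * 'I_t | (p.1 < p.2)%N && (s p.2 < s p.1)%N]|.

Definition qminor (I J : {set 'I_n}) : Oq :=
  \sum_(s : 'S_#|I|) (- q) ^+ perm_length s *:
    \prod_(l < #|I|) X (enum_val l) (nth (enum_val l) (enum J) (s l)).

End OqTheory.

Section IndexSets.
Variable n : nat.
Implicit Types A B S T U V Y Z : {set 'I_n}.

Definition set_le A B : bool :=
  all2 (fun i j : 'I_n => (i <= j)%N) (enum A) (enum B).

Definition set_lt A B : bool := set_le A B && (A != B).

Definition ell S T : nat :=
  #|[set p : 'I_n * 'I_n | [&& p.1 \in S, p.2 \in T & (p.2 < p.1)%N]]|.

Definition lt_family Y Z : {set {set 'I_n}} :=
  [set S : {set 'I_n} | [&& S \subset Y :|: Z, Y :&: Z \subset S,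
                            #|S| == #|Y| & set_lt S Y]].

Definition gt_family Y Z : {set {set 'I_n}} :=
  [set T : {set 'I_n} | [&& T \subset Y :|: Z, Y :&: Z \subset T,
                            #|T| == #|Y| & set_lt Y T]].

Definition natural Y Z S : {set 'I_n} := (Y :&: Z) :|: ((Y :|: Z) :\: S).

Definition calL S Y Z : int :=
  let P := (S :\: natural Y Z S) :|: (Z :\: Y) in
  (ell P (Y :\: S))%:Z - (ell P (S :\: Y))%:Z.

Definition calLnat T Y Z : int :=
  let P := (natural Y Z T :\: T) :|: (Y :\: Z) in
  (ell P (T :\: Y))%:Z - (ell P (Y :\: T))%:Z.

Variables (k : fieldType) (q : k).

Definition qint (d : nat) : k :=
  \sum_(0 <= i < d) (- q) ^ (d%:Z - 1 - (2 * i)%:Z).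

(* With l counted from 0, d_{l+1} = |[1, r_{l+1}] :&: V| - (l+1) + 1 is the
   difference below; the truncated subtraction is exact because xi U V is only
   meant for set_le V U, where every such number is at least 1. *)
Definition xi U V : k :=
  \prod_(l < #|U|)
    qint (#|[set v in V | (v <= enum_val l)%N]| - l).

Definition mu_tilde (I M S : {set 'I_n}) : k :=
  (- (q - q^-1)) ^+ #|S :\: I| * (- q) ^ (- calLnat S I M)
    * xi (S :\: I) (I :\: S).

Definition lambda_tilde (J N T : {set 'I_n}) : k :=
  (- (q - q^-1)) ^+ #|J :\: T| * (- q) ^ (- calL T J N)
    * xi (J :\: T) (T :\: J).

End IndexSets.

(* Main.v *)
(** Consider two copies e_i, f_i of the generators of the quantum exterior
    algebra, so that e_j e_i = -q e_i e_j for i < j and e_i^2 = 0, linked by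
      f_m e_i = e_i f_m - (q - q^-1) e_m f_i   (i < m),
      f_m e_i = e_i f_m   (m < i),     f_i e_i = q^-1 e_i f_i.
    The substitution e_i |-> sum_j X_ij e_j, f_i |-> sum_j X_ij f_j preserves all
    these relations, because of the relations between the X_ij, and it sends
    the product e_I to sum_J [I|J] e_J.  The relations alone imply
      f_M e_I = sum_S q^-|I :&: M| mu_S e_S f_{S natural},
    where S = I contributes with mu_I = 1; this is proved by induction on M,
    removing its least element.  Straightening f_M e_I before and after the
    substitution and comparing the coefficients of e_J f_N, which are linearly
    independent over A, gives the theorem, since lambda_T computed for (J, N)
    is mu_J computed for (T, T natural). *)

From HB Require Import structures.
Require Import Defs.
From mathcomp Require Import all_boot all_order perm all_algebra.
From mathcomp Require Import ring zify.
Set Implicit Arguments.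
Unset Strict Implicit.
Unset Printing Implicit Defensive.
Import GRing.Theory.
Local Open Scope ring_scope.

(** * A module with independent products e_J f_N *)

Section Fock.
Variables (k : fieldType) (q : k).
Hypothesis q0 : q != 0.
Local Notation t := (- q).
Local Notation qh := (q - q^-1).

Definition opprod (T : Type) (V : lmodType k) (e : T -> {linear V -> V})
  (s : seq T) (v : V) : V := foldr (fun i => e i) v s.

Fact opprod_linear T (V : lmodType k) (e : T -> {linear V -> V}) s :
  linear (opprod e s).
Proof.
by elim: s => [|i s IHs] a u v //; rewrite /opprod /= -!/(opprod _ _ _) IHs linearP.
Qed.
HB.instance Definition _ T (V : lmodType k) (e : T -> {linear V -> V}) s :=
  GRing.isLinear.Build k V V *:%R (opprod e s) (opprod_linear e s).

(* The e_i and the f_i act as the generators of two quantum exterior algebras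
   inside their braided tensor product. *)
Record qfermions (T : Type) (lt : rel T) (V : lmodType k)
    (e f : T -> {linear V -> V}) : Prop := QFermions {
  qf_ee : forall i v, e i (e i v) = 0;
  qf_ff : forall i v, f i (f i v) = 0;
  qf_eC : forall i j v, lt i j -> e j (e i v) = t *: e i (e j v);
  qf_fC : forall i j v, lt i j -> f j (f i v) = t *: f i (f j v);
  qf_fe_gt : forall i m v, lt i m ->
    f m (e i v) = e i (f m v) - qh *: e m (f i v);
  qf_fe_lt : forall i m v, lt m i -> f m (e i v) = e i (f m v);
  qf_fe_eq : forall i v, f i (e i v) = q^-1 *: e i (f i v) }.

(* A left A-module, presented by qact, in which the vectors e_b f_c qvac, for
   b and c subsets of {0, ..., n-1} given by characteristic functions, are
   independent over A: qcoef b c reads the coefficient of e_b f_c qvac. *)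
Record qfock (A : algType k) (n : nat) := QFock {
  qspace : lmodType k;
  qe : nat -> {linear qspace -> qspace};
  qf : nat -> {linear qspace -> qspace};
  qact : A -> {linear qspace -> qspace};
  qvac : qspace;
  qcoef : pred nat -> pred nat -> {linear qspace -> A};
  qferm : qfermions ltn qe qf;
  qact_linear : forall v, linear (qact^~ v);
  qact1 : forall v, qact 1 v = v;
  qactM : forall a b v, qact (a * b) v = qact a (qact b v);
  qe_act : forall i a v, qe i (qact a v) = qact a (qe i v);
  qf_act : forall i a v, qf i (qact a v) = qact a (qf i v);
  qcoef_act : forall b c a v, qcoef b c (qact a v) = a * qcoef b c v;
  qcoef_vac : forall b c b' c' : pred nat,
    qcoef b c (opprod qe [seq i <- iota 0 n | b' i]
              (opprod qf [seq i <- iota 0 n | c' i] qvac))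
    = (all (fun i => (b i == b' i) && (c i == c' i)) (iota 0 n))%:R }.

Section Base.
Variable A : algType k.
Let lmul (a : A) : A -> A := fun v => a * v.
Fact lmul_linear a : linear (lmul a).
Proof. by move=> c u v; rewrite /lmul mulrDr scalerAr. Qed.
HB.instance Definition _ a :=
  GRing.isLinear.Build k A A *:%R (lmul a) (lmul_linear a).

Lemma qfock0 : qfock A 0.
Proof.
pose z (_ : nat) : {linear A -> A} := (\0)%R.
pose l (a : A) : {linear A -> A} := lmul a.
apply: (@QFock A 0 A z z l 1 (fun _ _ => idfun)).
- by split=> * /=; rewrite ?scaler0 ?subrr.
- by move=> v c a b; rewrite /= /lmul mulrDl scalerAl.
- by move=> v; rewrite /= /lmul mul1r.
- by move=> a b v; rewrite /= /lmul mulrA.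
- by move=> i a v; rewrite /= /lmul mulr0.
- by move=> i a v; rewrite /= /lmul mulr0.
- by [].
- by [].
Qed.
End Base.

Section Step.
Variable V : lmodType k.
Local Notation W := ((V * V) * (V * V))%type.
Implicit Types (E F : {linear V -> V}) (w : W).

(* ((x1, xe), (xf, xef)) stands for x1 + e xe + f xf + e f xef, where e and f are
   the new generators of index 0; the maps site_e and site_f are left
   multiplications by e and f, while lift_e and lift_f extend the old generators
   so that they satisfy the commutation rules with e and f. *)
Definition site_e w : W := ((0, w.1.1), (0, w.2.1)).
Definition site_f w : W := ((0, 0), (w.1.1, q^-1 *: w.1.2)).
Definition lift_e E w : W :=
  ((E w.1.1, t *: E w.1.2), (E w.2.1, t *: E w.2.2)).
Definition lift_f E F w : W :=
  ((F w.1.1, F w.1.2), (t *: F w.2.1 - qh *: E w.1.2, t *: F w.2.2)).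
Definition lift_act E w : W := ((E w.1.1, E w.1.2), (E w.2.1, E w.2.2)).
Definition site_coef (b c : bool) w : V :=
  let p := if c then w.2 else w.1 in if b then p.2 else p.1.

Let pairP w w' : w.1.1 = w'.1.1 -> w.1.2 = w'.1.2 ->
  w.2.1 = w'.2.1 -> w.2.2 = w'.2.2 -> w = w'.
Proof. by case: w w' => [[? ?] [? ?]] [[? ?] [? ?]] /= -> -> -> ->. Qed.

Fact site_e_linear : linear site_e.
Proof. by move=> a u v; apply: pairP; rewrite /= ?scaler0 ?addr0. Qed.
Fact site_f_linear : linear site_f.
Proof.
move=> a u v; apply: pairP; rewrite /= ?scaler0 ?addr0 //.
by rewrite scalerDr !scalerA mulrC.
Qed.
Fact lift_e_linear E : linear (lift_e E).
Proof.
by move=> a u v; apply: pairP; rewrite /= linearP // scalerDr !scalerA mulrC.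
Qed.
Fact lift_f_linear E F : linear (lift_f E F).
Proof.
move=> a u v; apply: pairP; rewrite /= ?(linearP E) ?(linearP F) //.
  rewrite !scalerDr !scalerN !scalerA opprD [t * a]mulrC [qh * a]mulrC.
  by rewrite addrACA.
by rewrite scalerDr !scalerA mulrC.
Qed.
Fact lift_act_linear E : linear (lift_act E).
Proof. by move=> a u v; apply: pairP; rewrite /= linearP. Qed.
Fact site_coef_linear b c : linear (site_coef b c).
Proof. by case: b; case: c. Qed.

HB.instance Definition _ := GRing.isLinear.Build k W W *:%R site_e site_e_linear.
HB.instance Definition _ := GRing.isLinear.Build k W W *:%R site_f site_f_linear.
HB.instance Definition _ E :=
  GRing.isLinear.Build k W W *:%R (lift_e E) (lift_e_linear E).
HB.instance Definition _ E F :=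
  GRing.isLinear.Build k W W *:%R (lift_f E F) (lift_f_linear E F).
HB.instance Definition _ E :=
  GRing.isLinear.Build k W W *:%R (lift_act E) (lift_act_linear E).
HB.instance Definition _ b c :=
  GRing.isLinear.Build k W V *:%R (site_coef b c) (site_coef_linear b c).
Definition cons_e (e : nat -> {linear V -> V}) (i : nat) : {linear W -> W} :=
  if i is j.+1 then lift_e (e j) else site_e.
Definition cons_f (e f : nat -> {linear V -> V}) (i : nat) : {linear W -> W} :=
  if i is j.+1 then lift_f (e j) (f j) else site_f.

Let sub_collect (A x y : V) (b c d d' : k) : d = d' + c ->
  A - (b *: x - c *: y) - d *: y = A - d' *: y - b *: x.
Proof.
move=> ->; rewrite opprB scalerDl [d' *: y + _]addrC opprD !addrA.
by rewrite [A + c *: y - _]addrAC addrK addrAC.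
Qed.

Lemma qfermions_cons e f :
  qfermions ltn e f -> qfermions ltn (cons_e e) (cons_f e f).
Proof.
case=> ee ff eC fC fe_gt fe_lt fe_eq.
have eZ i a v : e i (a *: v) = a *: e i v by rewrite linearZ.
have fZ i a v : f i (a *: v) = a *: f i v by rewrite linearZ.
have fB i u v : f i (u - v) = f i u - f i v by rewrite linearB.
have eB i u v : e i (u - v) = e i u - e i v by rewrite linearB.
have e_0 i : e i 0 = 0 by rewrite linear0.
have f_0 i : f i 0 = 0 by rewrite linear0.
pose vE := (eZ, fZ, fB, eB, e_0, f_0, @scalerBr k V,
  @scalerDr k V, @scalerN k V, @scalerA k V,
  @scaler0 k V, @subr0 V, @addr0 V, @sub0r V, @oppr0 V).
split.
- by case=> [|i] w; apply: pairP; rewrite /= ?vE ?ee ?vE.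
- case=> [|i] w; apply: pairP; rewrite /= ?vE ?ff ?fe_eq ?vE; try reflexivity.
  rewrite -opprD -scalerDl.
  have -> : t * (q - q^-1) / q + (q - q^-1) = 0 by field.
  by rewrite scale0r oppr0.
- by case=> [|i] [|j] w ij;
     [elim (notF ij) | | elim (notF ij) | have {}ij : ltn i j := ij];
     apply: pairP; rewrite /= ?vE ?(eC _ _ _ ij) ?vE.
- case=> [|i] [|j] w ij;
    [by elim (notF ij) | | by elim (notF ij) | have {}ij : ltn i j := ij];
    (apply: pairP; rewrite /= ?vE ?(fC _ _ _ ij) ?(fe_gt _ _ _ ij)
                           ?(fe_lt _ _ _ ij) ?vE);
    try reflexivity.
  by apply: sub_collect; field.
- case=> [|i] [|j] w ij;
    [by elim (notF ij) | | by elim (notF ij) | have {}ij : ltn i j := ij];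
    (apply: pairP; rewrite /= ?vE ?(eC _ _ _ ij) ?(fe_gt _ _ _ ij)
                           ?(fe_lt _ _ _ ij) ?vE); try reflexivity.
  + rewrite -addrA -opprD -scalerDl.
    have -> : (q - q^-1) + (q - q^-1) * t / q = 0 by field.
    by rewrite scale0r subr0.
  + by congr (_ - _ *: _); ring.
  + rewrite [(q - q^-1) * t]mulrC; symmetry.
    by rewrite [LHS]addrAC [RHS]addrAC; apply: sub_collect; field.
  + by congr (_ - _ *: _); ring.
- case=> [|i] [|j] w ij;
    [by elim (notF ij) | by elim (notF ij) | | have {}ij : ltn j i := ij];
    (apply: pairP; rewrite /= ?vE ?(eC _ _ _ ij) ?(fe_gt _ _ _ ij)
                           ?(fe_lt _ _ _ ij) ?vE); try reflexivity.
  by congr (_ *: _); ring.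
- case=> [|i] w;
    (apply: pairP; rewrite /= ?vE ?fe_eq ?ee ?vE); try reflexivity;
    by congr (_ *: _); ring.
Qed.

Variables (A : algType k) (act : A -> {linear V -> V}).
Definition site_act (a : A) : {linear W -> W} := lift_act (act a).

Lemma opprod_iotaS (U : lmodType k) (g : nat -> {linear U -> U}) (b : pred nat) n u :
  opprod g [seq i <- iota 0 n.+1 | b i] u =
  (if b 0 then g 0 : U -> U else id)
    (opprod (g \o S) [seq i <- iota 0 n | b i.+1] u).
Proof.
rewrite /= -add1n iotaDl filter_map.
have map_g s : opprod g (map (addn 1) s) u = opprod (g \o S) s u.
  by elim: s => //= i s IHs; rewrite /opprod /= -!/(opprod _ _ _) IHs.
by case: (b 0); rewrite /opprod /= -!/(opprod _ _ _) map_g.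
Qed.

Lemma opprod_lift_e e s x y :
  opprod (cons_e e \o S) s ((x, 0), (y, 0)) =
  ((opprod e s x, 0), (opprod e s y, 0)).
Proof.
elim: s => // i s; rewrite /opprod /= -!/(opprod _ _ _) => ->.
by apply: pairP; rewrite /= ?linear0 ?scaler0.
Qed.

Lemma opprod_lift_f e f s x :
  opprod (cons_f e f \o S) s ((x, 0), (0, 0)) = ((opprod f s x, 0), (0, 0)).
Proof.
elim: s => // i s; rewrite /opprod /= -!/(opprod _ _ _) => ->.
by apply: pairP; rewrite /= ?linear0 ?scaler0 ?addr0.
Qed.
End Step.

Lemma qfock_cons (A : algType k) n : qfock A n -> qfock A n.+1.
Proof.
case=> V e f act vac coef ferm act_lin act1 actM e_act f_act coef_act coef_vac.
have actZ a c v : act a (c *: v) = c *: act a v by rewrite linearZ.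
have actB a u v : act a (u - v) = act a u - act a v by rewrite linearB.
pose W := ((V * V) * (V * V))%type.
pose coefS (b c : pred nat) : {linear W -> A} :=
  coef (b \o S) (c \o S) \o @site_coef V (b 0) (c 0).
apply: (@QFock A n.+1 W (cons_e e) (cons_f e f) (site_act act) ((vac, 0), (0, 0)) coefS).
- exact: qfermions_cons.
- by move=> w a x y; rewrite /= /lift_act /= !act_lin.
- by case=> [[? ?] [? ?]]; rewrite /= /lift_act /= !act1.
- by move=> a b [[? ?] [? ?]]; rewrite /= /lift_act /= !actM.
- case=> [|i] a w; rewrite /= /lift_act /= /site_e /lift_e /= ?linear0 //.
  by rewrite !e_act !actZ.
- case=> [|i] a w; rewrite /= /lift_act /= /site_f /lift_f /= ?linear0 ?actZ //.
  by rewrite !f_act !e_act actB !actZ.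
- by move=> b c a w; rewrite /coefS /= /site_coef; case: (b 0) (c 0) => [] [] /=.
move=> b c b' c'; rewrite !opprod_iotaS opprod_lift_f.
have -> : (if c' 0 then cons_f e f 0 : W -> W else id)
    ((opprod f [seq i <- iota 0 n | c' i.+1] vac, 0), (0, 0)) =
    (((~~ c' 0)%:R *: opprod f [seq i <- iota 0 n | c' i.+1] vac, 0),
     ((c' 0)%:R *: opprod f [seq i <- iota 0 n | c' i.+1] vac, 0)).
  by case: (c' 0); rewrite /= ?scale1r ?scale0r // /site_f /= scaler0.
rewrite opprod_lift_e !linearZ.
have -> : all (fun i => (b i == b' i) && (c i == c' i)) (iota 0 n.+1) =
    [&& b 0 == b' 0, c 0 == c' 0 &
        all (fun i => (b i.+1 == b' i.+1) && (c i.+1 == c' i.+1)) (iota 0 n)].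
  by rewrite /= -[iota 1 n](map_id) (iotaDl 1 0) -map_comp all_map andbA.
have := coef_vac (b \o S) (c \o S) (b' \o S) (c' \o S).
rewrite /coefS /= /site_coef; set x := opprod e _ _ => coefE.
case: (b 0) (c 0) (b' 0) (c' 0) => [] [] [] [];
  by rewrite /= ?linear0 ?scale1r ?scale0r ?linear0 ?coefE.
Qed.

Lemma qfock_exists (A : algType k) n : qfock A n.
Proof. by elim: n => [|n]; [exact: qfock0 | exact: qfock_cons]. Qed.

End Fock.

(** * Sets of indices and the coefficients xi *)

Section OrderedSets.
Variable n : nat.
Implicit Types (A B P S T U V : {set 'I_n}) (a i m x : 'I_n).

Definition below S i : nat := #|[set x in S | (x < i)%N]|.
Definition above S i : nat := #|[set x in S | (i < x)%N]|.

Lemma set_min_ind (Q : {set 'I_n} -> Prop) :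
  Q set0 ->
  (forall a S, {in S, forall x, (a < x)%N} -> Q S -> Q (a |: S)) ->
  forall S, Q S.
Proof.
move=> Q0 QS S; have [c] := ubnP #|S|; elim: c S => // c IHc S ltSc.
have [->|[i0 i0S]] := set_0Vmem S; first exact: Q0.
have [a aS a_min] := arg_minnP (fun x : 'I_n => x : nat) i0S.
rewrite -(setD1K aS); apply: QS => [x|]; last first.
  by apply: IHc; move: ltSc; rewrite (cardsD1 a) (aS : a \in S).
rewrite !inE => /andP[xa xS]; rewrite ltn_neqAle a_min // andbT.
by rewrite eq_sym.
Qed.

Lemma below_count S i : below S i = (\sum_(x in S) (x < i))%N.
Proof.
rewrite /below -sum1_card big_mkcond [RHS]big_mkcond.
by apply: eq_bigr => x _; rewrite inE; case: (x \in S); case: (x < i)%N.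
Qed.

Lemma above_count S i : above S i = (\sum_(x in S) (i < x))%N.
Proof.
rewrite /above -sum1_card big_mkcond [RHS]big_mkcond.
by apply: eq_bigr => x _; rewrite inE; case: (x \in S); case: (i < x)%N.
Qed.

Lemma mem_count S i : (i \in S : nat) = (\sum_(x in S) (x == i))%N.
Proof.
have [iS|iS] := boolP (i \in S).
  by rewrite (bigD1 i) //= eqxx big1 // => x /andP[_ /negPf->].
by rewrite big1 // => x xS; case: eqP => // xi; rewrite -xi xS in iS.
Qed.

Lemma belowU1 S a i : a \notin S -> below (a |: S) i = ((a < i) + below S i)%N.
Proof. by move=> aS; rewrite !below_count big_setU1. Qed.

Lemma aboveU1 S a i : a \notin S -> above (a |: S) i = ((i < a) + above S i)%N.
Proof. by move=> aS; rewrite !above_count big_setU1. Qed.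

Lemma belowD1 S a i : a \in S -> below S i = ((a < i) + below (S :\ a) i)%N.
Proof. by move=> aS; rewrite -belowU1 ?setD1K // !inE eqxx. Qed.

Lemma below_above S i : (below S i + (i \in S) + above S i)%N = #|S|.
Proof.
rewrite below_count above_count.
rewrite mem_count -!big_split -sum1_card; apply: eq_bigr => x _ /=.
by rewrite -val_eqE /=; case: ltngtP.
Qed.

Lemma eq_below A B m i : {in [pred x : 'I_n | x < m]%N, A =i B} -> (i <= m)%N ->
  below A i = below B i.
Proof.
move=> eqAB im; apply: eq_card => x; rewrite !inE.
by have [xi|_] := ltnP x i; rewrite ?andbF // eqAB // inE (leq_trans xi).
Qed.

Lemma below0 A i : {in A, forall x, (i <= x)%N} -> below A i = 0.
Proof.
move=> iA; apply/eqP; rewrite cards_eq0; apply/eqP/setP => x; rewrite !inE.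
by apply/negP => /andP[/iA]; rewrite ltnNge => ->.
Qed.

Lemma sorted_enum A : sorted (fun x y : 'I_n => (x < y)%N) (enum A).
Proof.
have : subseq (map val (enum A)) (iota 0 n).
  by rewrite -val_enum_ord enumT map_subseq // filter_subseq.
by move/(subseq_sorted ltn_trans)/(_ (iota_ltn_sorted 0 n)); rewrite sorted_map.
Qed.

Lemma enum_val_ltn A (i j : 'I_#|A|) : (enum_val i < enum_val j)%N = (i < j)%N.
Proof.
have mono (a b : 'I_#|A|) : (a < b)%N -> (enum_val a < enum_val b)%N.
  move=> ab; rewrite /enum_val.
  rewrite (set_nth_default (enum_default b)) -?cardE //.
  apply: (sorted_ltn_nth _ _ (sorted_enum A)) => //.
  - by move=> y x z; apply: ltn_trans.
  - by rewrite inE -cardE.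
  - by rewrite inE -cardE.
case: (ltngtP i j) => [/mono //|/mono ji|/val_inj ->]; last by rewrite ltnn.
by apply/negbTE; rewrite -leqNgt ltnW.
Qed.

Lemma below_enum_val A (i : 'I_#|A|) : below A (enum_val i) = i.
Proof.
rewrite below_count big_enum_val (eq_bigr (fun j : 'I__ => (j < i)%N : nat)).
  rewrite -big_mkcond -(big_ord_widen _ (fun=> 1%N)) 1?ltnW //.
  by rewrite sum1_card card_ord.
by move=> j _; rewrite enum_val_ltn.
Qed.

Lemma sum_below (R : nmodType) A (g : nat -> R) :
  \sum_(i in A) g (below A i) = \sum_(0 <= j < #|A|) g j.
Proof.
rewrite big_enum_val big_mkord; apply: eq_bigr => i _.
by rewrite below_enum_val.
Qed.

Lemma sum_below_lt (R : nmodType) A m (g : nat -> R) :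
  \sum_(i in A | (i < m)%N) g (below A i) = \sum_(0 <= j < below A m) g j.
Proof.
rewrite -sum_below; apply: eq_big => [i|i /andP[_ im]]; first by rewrite !inE.
congr g; apply: eq_card => x; rewrite !inE.
by case: (ltnP x i) => [xi|]; rewrite ?andbF // (ltn_trans xi im) !andbT.
Qed.

Lemma ellE P T : ell P T = (\sum_(x in T) above P x)%N.
Proof.
under eq_bigr do rewrite above_count.
rewrite exchange_big pair_big_dep -big_mkcondr sum1_card /= /ell.
by apply: eq_card => -[y x]; rewrite inE unfold_in /= andbA.
Qed.

Lemma ell_setU1r P x T : x \notin T -> ell P (x |: T) = (above P x + ell P T)%N.
Proof. by move=> xT; rewrite !ellE big_setU1. Qed.

Lemma ell_setD1r P x T : x \in T -> ell P T = (above P x + ell P (T :\ x))%N.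
Proof. by move=> xT; rewrite -ell_setU1r ?setD1K // !inE eqxx. Qed.

Lemma ell_setU1l P x T : x \notin P -> ell (x |: P) T = (below T x + ell P T)%N.
Proof.
move=> xP; rewrite !ellE; under eq_bigr do rewrite aboveU1 //.
rewrite big_split /=; congr (_ + _)%N.
by rewrite -big_mkcondr sum1_card /below; apply: eq_card => y; rewrite !inE.
Qed.

End OrderedSets.

Section Xi.
Variables (n : nat) (k : fieldType) (q : k).
Hypothesis q0 : q != 0.
Implicit Types (A B P S T U V : {set 'I_n}) (a i m x : 'I_n).
Local Notation t := (- q).
Local Notation qh := (q - q^-1).

Let t0 : t != 0. Proof. by rewrite oppr_eq0. Qed.

Lemma qintE d : qint q d = \sum_(0 <= j < d) t ^ (2 * j%:Z + 1 - d%:Z).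
Proof.
rewrite /qint big_nat_rev; apply: eq_big_nat => j /andP[_ jd] /=.
by congr (_ ^ _); rewrite add0n; lia.
Qed.

Lemma qintM d : qh * qint q d = t ^ (- d%:Z) - t ^ d%:Z.
Proof.
rewrite qintE mulr_sumr.
rewrite (eq_bigr (fun j : nat => - t ^ (2 * j.+1%:Z - d%:Z)
                               - - t ^ (2 * j%:Z - d%:Z))) => [|j _].
  rewrite telescope_sumr // opprK addrC mulr0 add0r.
  by congr (_ ^ _ - _ ^ _); lia.
rewrite opprK (_ : 2 * j.+1%:Z - d%:Z = 2 * j%:Z - d%:Z + 1 + 1); last by lia.
rewrite (_ : 2 * j%:Z + 1 - d%:Z = 2 * j%:Z - d%:Z + 1); last by lia.
by rewrite !expfzDr // expr1z; field.
Qed.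

Lemma sum_qint V m :
  \sum_(i in V | (i < m)%N) t ^ (2 * (below V i)%:Z + 1 - (below V m)%:Z)
  = qint q (below V m).
Proof.
by rewrite (sum_below_lt V m (fun j => t ^ (2 * j%:Z + 1 - (below V m)%:Z))) qintE.
Qed.

Lemma xiE U V : [disjoint U & V] ->
  xi q U V = \prod_(u in U) qint q (below V u - below U u).
Proof.
move=> UV; rewrite /xi [RHS]big_enum_val; apply: eq_bigr => l _ /=.
rewrite below_enum_val; congr (qint q (_ - _)%N); apply: eq_card => v.
rewrite !inE leq_eqVlt val_eqE; case: eqP => //= ->; rewrite ltnn andbF andbT.
exact: (disjointFr UV (enum_valP l)).
Qed.

Lemma xi_min U V m : [disjoint U & V] -> m \in U ->
  {in U, forall u : 'I_n, (m <= u)%N} ->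
  xi q U V = qint q (below V m)
    * \prod_(u in U :\ m) qint q (below V u - below U u).
Proof.
move=> UV mU m_min; rewrite xiE // (big_setD1 m) //=.
by rewrite (below0 m_min) subn0.
Qed.

Lemma xi_rem U V m i : [disjoint U & V] -> m \in U ->
  {in U, forall u : 'I_n, (m <= u)%N} -> i \in V -> (i < m)%N ->
  xi q (U :\ m) (V :\ i) = \prod_(u in U :\ m) qint q (below V u - below U u).
Proof.
move=> UV mU m_min iV im; rewrite xiE; last first.
  exact/(disjointWl (subD1set _ _))/(disjointWr (subD1set _ _)).
apply: eq_bigr => u; rewrite !inE => /andP[um uU].
have mu : (m < u)%N by rewrite ltn_neqAle m_min // andbT eq_sym.
by rewrite [below U u](belowD1 _ mU) [below V u](belowD1 _ iV) mu (ltn_trans im mu).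
Qed.

Lemma xi_swap U V m i : [disjoint U & V] -> m \notin U -> m \notin V ->
  {in U, forall u : 'I_n, (m <= u)%N} -> i \in V -> (i < m)%N ->
  xi q U (m |: V :\ i) = xi q U V.
Proof.
move=> UV mU mV m_min iV im; rewrite !xiE //; last first.
  apply/pred0P => x /=; rewrite !inE; case xU: (x \in U) => //=.
  by rewrite (disjointFr UV xU) andbF orbF; apply: contraNF mU => /eqP<-.
apply: eq_bigr => u uU.
have mu : (m < u)%N.
  by rewrite ltn_neqAle m_min // andbT; apply: contraNneq mU => /val_inj->.
rewrite belowU1 ?inE ?(negPf mV) ?andbF // [below V u](belowD1 _ iV).
by rewrite mu (ltn_trans im mu).
Qed.

Lemma xi_neq0 U V u : [disjoint U & V] -> xi q U V != 0 -> u \in U ->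
  (below U u < below V u)%N.
Proof.
move=> UV; rewrite xiE // => /prodf_neq0 xi0 uU; move: (xi0 u uU).
by apply: contraR; rewrite -leqNgt => /eqP->; rewrite /qint big_nil.
Qed.

(* If A <= B fails, the truncated subtraction in xi makes some factor qint 0. *)
Lemma xi_set_le A B : #|A| = #|B| -> xi q (B :\: A) (A :\: B) != 0 -> set_le A B.
Proof.
set U := B :\: A; set V := A :\: B => AB xiUV.
have UV : [disjoint U & V].
  apply/pred0P => x; rewrite !inE.
  by case: (x \in A); case: (x \in B).
rewrite /set_le all2E -!cardE AB eqxx /=.
have [A0|[d _]] := set_0Vmem A; first by rewrite A0 enum_set0; case: (enum B).
apply/(all_nthP (d, d)) => l; rewrite size_zip -!cardE AB minnn => lB.
have lA : (l < #|A|)%N by rewrite AB.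
rewrite nth_zip -?cardE //=.
rewrite -(enum_val_nth d (Ordinal lA)) -(enum_val_nth d (Ordinal lB)).
have := below_enum_val (Ordinal lA); have := below_enum_val (Ordinal lB).
have := enum_valP (Ordinal lB).
set i := enum_val (Ordinal lA); set s := enum_val (Ordinal lB) => /= sB belowB belowA.
rewrite leqNgt; apply/negP => si.
have belowAs : (below A s + (s \in A) <= below A i)%N.
  rewrite !below_count mem_count -big_split; apply: leq_sum => x _ /=.
  by rewrite -val_eqE /=; lia.
have belowID C D : below C s = (below (C :&: D) s + below (C :\: D) s)%N.
  by rewrite !below_count (big_setID D).
have := belowID A B; have := belowID B A; rewrite setIC -/U -/V => eB eA.
have sU : (s \in U) = (s \notin A) by rewrite inE sB andbT.
have [u0 u0U|U0] := pickP [pred x in U | (x <= s)%N]; last first.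
  have /negbT := U0 s; rewrite inE leqnn andbT sU negbK => sA.
  have : below U s = 0.
    rewrite below_count big1 // => x xU; have := U0 x; rewrite inE xU /=; lia.
  by rewrite sA in belowAs; lia.
have [u /andP[/= uU us] u_max] := arg_maxnP (fun x : 'I_n => x : nat) u0U.
have := xi_neq0 UV xiUV uU.
have : (below V u <= below V s)%N.
  by rewrite !below_count; apply: leq_sum => x _; lia.
have : (below U s + (s \in U) <= below U u + 1)%N.
  rewrite -[1%N]/(true : nat) -uU !below_count !mem_count -!big_split.
  apply: leq_sum => x xU /=; rewrite -!val_eqE /=.
  have := u_max x; move=> /=; rewrite xU /=; lia.
rewrite sU; case: (s \in A) belowAs => /=; lia.
Qed.
End Xi.

Section Coefficients.
Variables (n : nat) (k : fieldType) (q : k).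
Hypothesis q0 : q != 0.
Implicit Types (A B P S T U V I M : {set 'I_n}) (a i m x : 'I_n).
Local Notation t := (- q).
Local Notation qh := (q - q^-1).

Let t0 : t != 0. Proof. by rewrite oppr_eq0. Qed.

Definition exchanges I M : {set {set 'I_n}} :=
  [set S : {set 'I_n} | [&& S \subset I :|: M, I :&: M \subset S & #|S| == #|I|]].

(* The entry at (e_S f_{S natural}, f_M e_I) of the R-matrix. *)
Definition braid_coef I M S : k := q ^- #|I :&: M| * mu_tilde q I M S.

Let rest I M S := (natural I M S :\: S) :|: (I :\: M).

Let braid_coefE I M S : braid_coef I M S =
  q ^- #|I :&: M| * ((- qh) ^+ #|S :\: I|
    * t ^ (- ((ell (rest I M S) (S :\: I))%:Z - (ell (rest I M S) (I :\: S))%:Z))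
    * xi q (S :\: I) (I :\: S)).
Proof. by []. Qed.

Section Step.
Variables (I M S : {set 'I_n}) (m : 'I_n).
Hypothesis mM : {in M, forall x, (m < x)%N}.
Hypothesis S_ex : S \in exchanges I (m |: M).
Local Notation U := (S :\: I).
Local Notation V := (I :\: S).
Local Notation P := (rest I (m |: M) S).

Let mNM : m \notin M. Proof. by apply/negP => /mM; rewrite ltnn. Qed.

Let sub_S x : x \in I -> (x == m) || (x \in M) -> x \in S.
Proof.
move=> xI xM; move: S_ex; rewrite inE => /and3P[_ /subsetP IMS _].
by apply: IMS; rewrite !inE xI.
Qed.

Let S_sub x : x \in S -> [|| x \in I, x == m | x \in M].
Proof.
by move=> xS; move: S_ex; rewrite inE => /and3P[/subsetP/(_ _ xS)]; rewrite !inE.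
Qed.

Let UV : [disjoint U & V].
Proof. by apply/pred0P => x; rewrite !inE; case: (x \in I); case: (x \in S). Qed.

Let m_min : {in U, forall u : 'I_n, (m <= u)%N}.
Proof.
move=> u; rewrite inE => /andP[/negPf uI /S_sub]; rewrite uI /=.
by case/orP => [/eqP->//|/mM/ltnW].
Qed.

Lemma braid_coef_notin : m \notin S ->
  braid_coef I (m |: M) S = t ^ (below V m)%:Z * braid_coef I M S.
Proof.
move=> mS; have mI : m \notin I.
  by apply: contra mS => mI; rewrite sub_S // eqxx.
rewrite !braid_coefE.
have -> : I :&: (m |: M) = I :&: M.
  by apply/setP => x; rewrite !inE; case: eqP => // ->; rewrite (negPf mI).
have -> : P = m |: rest I M S.
  apply/setP => x; rewrite /rest /natural !inE; case: eqP => [->|_] //=.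
  by rewrite (negPf mI) (negPf mS).
have mP : m \notin rest I M S.
  by rewrite /rest /natural !inE (negPf mI) (negPf mNM) !andbF.
rewrite !ell_setU1l // (@below0 _ U) ?m_min //.
have -> : - ((0 + ell (rest I M S) U)%:Z - (below V m + ell (rest I M S) V)%:Z) =
    (below V m)%:Z - ((ell (rest I M S) U)%:Z - (ell (rest I M S) V)%:Z).
  by clear; lia.
by rewrite expfzDr // ; ring.
Qed.

Let restE x : (x \in P) =
  if x \in S then [&& x \in I, x != m & x \notin M]
  else [|| x \in I, x == m | x \in M].
Proof.
have := @sub_S x; rewrite /rest /natural !inE.
by case: (x \in I); case: (x == m); case: (x \in M); case: (x \in S) => //=
  => [/(_ isT isT)|/(_ isT isT)|/(_ isT isT)].
Qed.

Let below_rest x : (x <= m)%N -> below P x = (below S x + below V x)%N.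
Proof.
move=> xm; rewrite (@eq_below _ _ I m) // => [|y].
  rewrite !below_count (big_setID S) [in RHS](big_setID I) /= setIC.
  rewrite [X in (_ + X + _)%N]big1 ?addn0 // => y yU.
  by have := m_min yU; lia.
rewrite inE /= => ym; rewrite restE.
have yM : y \notin M by apply/negP => /mM; lia.
have ynm : y != m by rewrite -val_eqE /=; lia.
by rewrite (negPf ynm) (negPf yM) /= orbF andbT; case: ifP.
Qed.

Let above_rest i : m \notin P -> i \in V -> (i < m)%N ->
  (above P i)%:Z - (above P m)%:Z
  = (below S m + below V m)%:Z - (below S i + below V i)%:Z - 1 :> int.
Proof.
move=> mP iV im; have iP : i \in P.
  by move: iV; rewrite restE inE => /andP[/negPf -> ->].
have := below_above P i; have := below_above P m.
by rewrite iP (negPf mP) !below_rest ?(ltnW im) //; clear; lia.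
Qed.

Let swap_exp i := ((below S m)%:Z - (below S i)%:Z + (below V i)%:Z).

(* Moving m into S expels some i < m from I; the powers of -q obtained for the
   possible i form a geometric progression whose sum is the first factor of xi. *)
Lemma braid_coef_in : m \in S ->
  braid_coef I (m |: M) S =
  (if m \in I then q^-1 * t ^ (below V m)%:Z * braid_coef I M S else 0)
  - qh * \sum_(i in V | (i < m)%N)
           t ^ swap_exp i * braid_coef I M (i |: S :\ m).
Proof.
move=> mS.
have mP : m \notin P by rewrite restE mS eqxx andbF.
have SmI i : i \in V -> (i < m)%N -> I :\: (i |: S :\ m) =
    if m \in I then m |: V :\ i else V :\ i.
  rewrite inE => /andP[iS iI] im; apply/setP => x.
  have [mI|mI] := boolP (m \in I); rewrite !inE.
    case: (eqVneq x m) => [->|xm]; last by rewrite negb_or andbA.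
    by rewrite mI -val_eqE /= gtn_eqF.
  case: (eqVneq x m) => [->|xm]; last by rewrite negb_or andbA.
  by rewrite (negPf mI) !andbF.
have US i : i \in I -> (i |: S :\ m) :\: I = U :\ m.
  move=> iI; apply/setP => x; rewrite !inE.
  by case: (eqVneq x i) => [->|_] /=; rewrite ?iI ?andbF // andbCA.
have restS i : i \in I -> i \notin S -> (i < m)%N ->
    rest I M (i |: S :\ m) = if m \in I then m |: P else P.
  move=> iI iS im.
  have iM : i \notin M by apply/negP => /mM; rewrite ltnNge (ltnW im).
  have im' : (i == m) = false by rewrite -val_eqE /= ltn_eqF.
  apply/setP => x; rewrite (fun_if (fun A : {set 'I_n} => x \in A)) in_setU1 restE.
  rewrite /rest /natural !inE.
  case: (eqVneq x i) => [->|xi] /=.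
    by rewrite im' iI iM (negPf iS) /=; case: ifP.
  case: (eqVneq x m) => [->|xm] /=.
    by rewrite mS (negPf mNM); case: (m \in I).
  have := @sub_S x; rewrite (negPf xm).
  by case: (m \in I); case: (x \in I); case: (x \in M); case: (x \in S)
    => //= /(_ isT isT).
have restC : m \in I -> rest I M S = m |: P.
  move=> mI.
  apply/setP => x; rewrite in_setU1 restE /rest /natural !inE.
  case: (eqVneq x m) => [->|xm] /=; first by rewrite mI (negPf mNM) orbT.
  have := @sub_S x; rewrite (negPf xm).
  by case: (x \in I); case: (x \in M); case: (x \in S) => //= /(_ isT isT).
have [mI|mI] := boolP (m \in I); last first.
  rewrite sub0r !braid_coefE.
  have mU : m \in U by rewrite inE mI.
  have -> : I :&: (m |: M) = I :&: M.
    by apply/setP => x; rewrite !inE; case: eqP => // ->; rewrite (negPf mI).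
  pose Y := \prod_(u in U :\ m) qint q (below V u - below U u).
  rewrite (xi_min _ UV mU m_min) -sum_qint // -/Y mulrA !mulr_suml !mulr_sumr -sumrN.
  apply: eq_bigr => i /andP[iV im].
  have /andP[iS iI] : (i \notin S) && (i \in I) by rewrite inE in iV.
  rewrite !braid_coefE restS // US // SmI // (negPf mI) (xi_rem _ UV mU m_min) // -/Y.
  rewrite (cardsD1 m U) mU (ell_setD1r P mU) (ell_setD1r P iV) add1n exprS.
  have expE : t ^ (- ((above P m + ell P (U :\ m))%:Z
                      - (above P i + ell P (V :\ i))%:Z))
      * t ^ (2 * (below V i)%:Z + 1 - (below V m)%:Z)
      = t ^ swap_exp i * t ^ (- ((ell P (U :\ m))%:Z - (ell P (V :\ i))%:Z)).
    rewrite -!expfzDr //; congr (_ ^ _).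
    by move: (above_rest mP iV im); rewrite /swap_exp; clear; lia.
  transitivity (q ^- #|I :&: M| * - qh * (- qh) ^+ #|U :\ m| * Y *
      (t ^ (- ((above P m + ell P (U :\ m))%:Z
                      - (above P i + ell P (V :\ i))%:Z))
      * t ^ (2 * (below V i)%:Z + 1 - (below V m)%:Z))); first by ring.
  by rewrite expE; ring.
have cardI : #|I :&: (m |: M)| = #|I :&: M|.+1.
  rewrite (cardsD1 m) !inE mI eqxx /= add1n; congr _.+1; apply: eq_card => x.
  by rewrite !inE; case: (eqVneq x m) => [->|//]; rewrite (negPf mNM) andbF.
have mU : m \notin U by rewrite inE mI.
have mV : m \notin V by rewrite inE mS.
pose c := q ^- #|I :&: M| * (- qh) ^+ #|U| * xi q U V.
pose E : int := (ell P U)%:Z - (ell P V)%:Z.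
have -> : braid_coef I (m |: M) S = q^-1 * c * t ^ (- E).
  by rewrite braid_coefE cardI /c exprS invfM /E; ring.
have -> : braid_coef I M S = c * t ^ (- E + (below V m)%:Z).
  rewrite braid_coefE restC // !ell_setU1l // (@below0 _ U) ?m_min //.
  rewrite /c mulrAC -!mulrA.
  by congr (_ * (_ * (_ * t ^ _))); rewrite /E; clear; lia.
rewrite (eq_bigr (fun i => t ^ (2 * (below V i)%:Z + 1 - (below V m)%:Z) *
    (c * t ^ (- E + (below V m)%:Z - 1)))); last first.
  move=> i /andP[iV im].
  have /andP[iS iI] : (i \notin S) && (i \in I) by rewrite inE in iV.
  rewrite braid_coefE restS // US // SmI // mI.
  have -> : U :\ m = U by apply/setDidPl; rewrite disjoint_sym disjoints1.
  have mVi : m \notin V :\ i by rewrite in_setD1 (negPf mV) andbF.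
  rewrite xi_swap // !ell_setU1l // ell_setU1r // belowU1 // ltnn add0n.
  rewrite (@below0 _ U) ?m_min // /c.
  have expE : t ^ swap_exp i * t ^ (- ((0 + ell P U)%:Z
      - (below (V :\ i) m + (above P m + ell P (V :\ i)))%:Z))
      = t ^ (2 * (below V i)%:Z + 1 - (below V m)%:Z) * t ^ (- E + (below V m)%:Z - 1).
    rewrite -!expfzDr //; congr (_ ^ _); rewrite /swap_exp /E (ell_setD1r P iV).
    by move: (above_rest mP iV im) (belowD1 m iV); rewrite im; clear; lia.
  transitivity (q ^- #|I :&: M| * (- qh) ^+ #|U| * xi q U V *
    (t ^ swap_exp i * t ^ (- ((0 + ell P U)%:Z
      - (below (V :\ i) m + (above P m + ell P (V :\ i)))%:Z)))); first by ring.
  by rewrite expE; ring.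
rewrite -mulr_suml sum_qint // [qh * (_ * _)]mulrA qintM //.
have tN1 : t ^ (-1 : int) = - q^-1 by rewrite exprN1 invrN.
rewrite !expfzDr // tN1 -[t ^ (- (below V m)%:Z)]invr_expz.
move: (expfz_neq0 (below V m)%:Z t0) (t ^ (- E)) (t ^ _) => + w d => d0.
by field; rewrite q0.
Qed.
End Step.
End Coefficients.

(** * Straightening f_M e_I *)

Section Wedge.
Variables (n : nat) (k : fieldType) (q : k) (V : lmodType k).
Hypothesis q0 : q != 0.
Implicit Types (I M S T : {set 'I_n}) (a i j m x : 'I_n) (v : V).
Local Notation t := (- q).
Local Notation qh := (q - q^-1).
Local Notation wedge e S := (opprod e (enum S)).

Let t0 : t != 0. Proof. by rewrite oppr_eq0. Qed.

Lemma opprod_cat (g : 'I_n -> {linear V -> V}) s1 s2 v :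
  opprod g (s1 ++ s2) v = opprod g s1 (opprod g s2 v).
Proof. by rewrite /opprod foldr_cat. Qed.

Section Exterior.
Variable e : 'I_n -> {linear V -> V}.
Hypothesis ee : forall i v, e i (e i v) = 0.
Hypothesis eC : forall i j v, (i < j)%N -> e j (e i v) = t *: e i (e j v).

Lemma opprod_swap (s : seq 'I_n) i v : all (fun x : 'I_n => x < i)%N s ->
  e i (opprod e s v) = t ^+ size s *: opprod e s (e i v).
Proof.
elim: s => [|x s IHs] /= => [_|/andP[xi si]]; first by rewrite scale1r.
by rewrite /opprod /= -!/(opprod _ _ _) eC // IHs // linearZ /= scalerA exprS.
Qed.

Lemma enum_split i : exists s1 s2 : seq 'I_n,
  [/\ enum 'I_n = s1 ++ i :: s2, all (fun x : 'I_n => x < i)%N s1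
    & all (fun x : 'I_n => i < x)%N s2].
Proof.
have iE : i \in enum 'I_n by rewrite mem_enum.
have := sorted_enum [set: 'I_n]; rewrite (eq_enum (B := 'I_n)) //; last first.
  by move=> x; rewrite inE.
have [s1 s2] := path.splitPr iE => srt.
exists s1, s2; split=> //; move: srt;
  (rewrite sorted_pairwise; last by move=> y x z; apply: ltn_trans).
  rewrite pairwise_cat /= => /and3P[/allrelP s1i _ _]; apply/allP => x xs.
  by apply: s1i => //; rewrite inE eqxx.
by rewrite pairwise_cat /= => /and3P[_ _ /andP[]].
Qed.

Lemma wedge_insert S i v : e i (wedge e S v) =
  if i \in S then 0 else t ^+ below S i *: wedge e (i |: S) v.
Proof.
have [s1 [s2 [enumE s1i s2i]]] := enum_split i.
have enumSE T : enum T = [seq x <- enum 'I_n | x \in T].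
  by rewrite enumT.
have below_size : below S i = size [seq x <- s1 | x \in S].
  rewrite /below cardE enumSE enumE filter_cat size_cat /= inE ltnn andbF.
  rewrite [in X in (_ + X)%N](_ : [seq x <- s2 | _] = [::]).
    rewrite addn0; congr size; apply: eq_in_filter => x /(allP s1i) xi.
    by rewrite inE xi andbT.
  apply/eqP; rewrite -size_eq0 size_filter -leqn0 leqNgt -has_count.
  apply/hasPn => x /(allP s2i).
  by rewrite inE ltnNge => /negbTE xi; rewrite andbC (ltnNge x i) ltnW // ltnNge xi.
have filt T s : (forall x, x \in s -> x != i) ->
    [seq x <- s | x \in i |: T] = [seq x <- s | x \in T].
  by move=> si; apply: eq_in_filter => x /si; rewrite !inE => /negPf->.
rewrite !enumSE enumE !filter_cat /= !opprod_cat.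
have s1S : all (fun x : 'I_n => x < i)%N [seq x <- s1 | x \in S].
  by apply/allP => x; rewrite mem_filter => /andP[_]; apply: (allP s1i).
rewrite opprod_swap // below_size setU11.
have [iS|iS] := boolP (i \in S).
  by rewrite -[opprod e (i :: _) v]/(e i (opprod e _ v)) ee linear0 scaler0.
rewrite !filt // => x xs; apply: contraTneq xs => ->; apply/negP.
  by move/(allP s2i); rewrite ltnn.
by move/(allP s1i); rewrite ltnn.
Qed.

Lemma wedge_min S a v : {in S, forall x : 'I_n, (a < x)%N} ->
  wedge e (a |: S) v = e a (wedge e S v).
Proof.
move=> aS; rewrite wedge_insert below0 ?expr0 ?scale1r; last first.
  by move=> x /aS/ltnW.
by case: ifP => // /aS; rewrite ltnn.
Qed.

End Exterior.

Variables e f : 'I_n -> {linear V -> V}.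
Hypothesis ef : qfermions q (fun i j : 'I_n => ltn i j) e f.

Lemma fe_wedge S m v :
  f m (wedge e S v) = (if m \in S then q^-1 else 1) *: wedge e S (f m v)
    - qh *: \sum_(i in S | (i < m)%N)
        t ^- below S i *: e m (wedge e (S :\ i) (f i v)).
Proof.
case: ef => ee _ eC _ fe_gt fe_lt fe_eq.
elim/set_min_ind: S m v => [|a S aS IHS] m v.
  rewrite big_pred0 ?scaler0 ?subr0 => [|i]; last by rewrite !inE.
  by rewrite inE scale1r enum_set0.
have aNS : a \notin S by apply/negP => /aS; rewrite ltnn.
rewrite !(wedge_min ee eC _ aS).
have f_a u : f a (wedge e S u) = wedge e S (f a u).
  rewrite IHS (negPf aNS) scale1r big_pred0 ?scaler0 ?subr0 // => i.
  by apply/negP => /andP[/aS]; rewrite ltnNge => /negbTE ai /ltnW; rewrite ai.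
have eB u w : e a (u - w) = e a u - e a w by rewrite linearB.
have eZ c u : e a (c *: u) = c *: e a u by rewrite linearZ.
have sumU1 : \sum_(i in a |: S | (i < m)%N)
      t ^- below (a |: S) i *: e m (wedge e ((a |: S) :\ i) (f i v))
    = (if (a < m)%N then e m (wedge e S (f a v)) else 0)
      + \sum_(i in S | (i < m)%N)
          t ^- (below S i).+1 *: e m (e a (wedge e (S :\ i) (f i v))).
  rewrite big_mkcondr big_setU1 //= setU1K //; congr (_ + _).
    rewrite below0 ?invr1 ?scale1r // => x /setU1P[->//|/aS]; exact: ltnW.
  rewrite [RHS]big_mkcondr; apply: eq_bigr => i iS; case: ifP => // im.
  have -> : (a |: S) :\ i = a |: (S :\ i).
    apply/setP => x; rewrite !inE; case: (eqVneq x a) => [->|//].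
    by rewrite andbT (contraNneq _ aNS) // => ->.
  rewrite belowU1 // (aS _ iS) (wedge_min ee eC) // => x /setD1P[_]; exact: aS.
rewrite sumU1; case: (ltngtP a m) => [am|ma|/val_inj/esym am].
- have -> : (m \in a |: S) = (m \in S) by rewrite in_setU1 -val_eqE /= gtn_eqF.
  rewrite fe_gt // IHS f_a eB !eZ scalerDr opprD addrA addrAC /=.
  congr (_ - _ - _).
  congr (_ *: _); rewrite raddf_sum; apply: eq_bigr => i _.
  rewrite /= eZ (eC a m) // scalerA exprS invfM mulrAC mulVf ?mul1r //.
- have maS i : i \in S -> (i < m)%N = false.
    by move=> /aS ai; apply/negbTE; rewrite -leqNgt ltnW // (ltn_trans ma ai).
  have mS : (m \in S) = false by apply/negP => /aS; rewrite ltnNge ltnW.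
  rewrite add0r fe_lt // IHS in_setU1 mS -val_eqE /= (ltn_eqF ma) eB eZ /=.
  by rewrite !big_pred0 ?scaler0 ?linear0 // => i; apply/negP => /andP[/maS->].
rewrite am setU11 fe_eq f_a big_pred0 ?addr0 ?scaler0 ?subr0 // => i.
by apply/negP => /andP[/aS]; rewrite ltnNge => /negbTE ai /ltnW; rewrite ai.
Qed.

End Wedge.

Section Exchanges.
Variables (n : nat) (I M : {set 'I_n}) (m : 'I_n).
Hypothesis mM : {in M, forall x : 'I_n, (m < x)%N}.
Implicit Types (S T : {set 'I_n}) (i x : 'I_n).

Lemma exchangesP A B S : reflect
  [/\ {subset S <= A :|: B}, {in A, forall x, x \in B -> x \in S} & #|S| = #|A|]
  (S \in exchanges A B).
Proof.
rewrite inE; apply: (iffP and3P) => [[/subsetP SAB /subsetP ABS /eqP SA]|[SAB ABS SA]].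
  by split=> // x xA xB; apply: ABS; rewrite inE xA.
split; [exact/subsetP | | exact/eqP].
by apply/subsetP => x /setIP[]; exact: ABS.
Qed.

Let mNM : m \notin M. Proof. by apply/negP => /mM; rewrite ltnn. Qed.

Lemma exchanges_keep S :
  (S \in exchanges I M) && ((m \in I) ==> (m \in S))
  = (S \in exchanges I (m |: M)) && ((m \in S) ==> (m \in I)).
Proof.
apply/andP/andP => [] [/exchangesP[SIM IMS SI] /implyP mIS]; split.
- apply/exchangesP; split=> // [x /SIM|x xI /setU1P[xm|]]; last exact: IMS.
    by rewrite !inE => /orP[->//|->]; rewrite !orbT.
  by rewrite xm mIS -?xm.
- by apply/implyP => /SIM; rewrite inE (negPf mNM) orbF.
- apply/exchangesP; split=> // [x xS|x xI xM]; last by apply: IMS; rewrite // inE xM orbT.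
  have := SIM x xS; rewrite !inE; case: (eqVneq x m) => [xm _|_ //].
  by rewrite xm mIS -?xm.
by apply/implyP => mI'; apply: IMS; rewrite // setU11.
Qed.

Lemma exchanges_swap S i : S \in exchanges I M -> m \notin S -> i \in S -> (i < m)%N ->
  [/\ m |: S :\ i \in exchanges I (m |: M), i \in I & i \notin m |: S :\ i].
Proof.
move=> /exchangesP[SIM IMS SI] mS iS im.
have iM : i \notin M by apply/negP => /mM; rewrite ltnNge ltnW.
have im' : i != m by rewrite -val_eqE /= ltn_eqF.
split; last by rewrite !inE eqxx (negPf im').
  apply/exchangesP; split => [x|x xI|].
  - rewrite !inE => /orP[->|/andP[_ /SIM]]; rewrite ?orbT // inE.
    by case/orP=> ->; rewrite ?orbT.
  - case/setU1P=> [->|xM]; first exact: setU11.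
    rewrite !inE IMS // andbT (contraNneq _ iM) ?orbT // => <-; exact: xM.
  by rewrite cardsU1 !inE (negPf mS) andbF /= -SI (cardsD1 i S) iS.
by have := SIM i iS; rewrite inE (negPf iM) orbF.
Qed.

Lemma exchanges_unswap S i :
  S \in exchanges I (m |: M) -> m \in S -> i \in I -> i \notin S -> (i < m)%N ->
  i |: S :\ m \in exchanges I M /\ m \notin i |: S :\ m.
Proof.
move=> /exchangesP[SIM IMS SI] mS iI iS im.
have im' : m != i by rewrite -val_eqE /= gtn_eqF.
split; last by rewrite !inE eqxx (negPf im').
apply/exchangesP; split => [x|x xI xM|].
- rewrite !inE => /orP[/eqP->|/andP[xm /SIM]]; first by rewrite iI.
  by rewrite !inE (negPf xm).
- rewrite !inE IMS // ?inE ?xM ?orbT // andbT (contraNneq _ mNM) ?orbT // => <-; exact: xM.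
by rewrite cardsU1 !inE (negPf iS) andbF /= -SI (cardsD1 m S) mS.
Qed.

End Exchanges.

Section Straightening.
Variables (n : nat) (k : fieldType) (q : k) (V : lmodType k).
Hypothesis q0 : q != 0.
Implicit Types (I M S T : {set 'I_n}) (a i j m x : 'I_n) (v : V).
Local Notation t := (- q).
Local Notation qh := (q - q^-1).
Local Notation wedge e S := (opprod e (enum S)).
Let t0 : t != 0. Proof. by rewrite oppr_eq0. Qed.

Lemma braid_coef_id I M : braid_coef q I M I = q ^- #|I :&: M|.
Proof.
have xi0 : xi q (set0 : {set 'I_n}) set0 = 1.
  by rewrite xiE ?big_set0 //; apply/pred0P => x; rewrite !inE.
rewrite /braid_coef /mu_tilde /calLnat setDv xi0 cards0 !ellE !big_set0.
by rewrite subrr oppr0 expr0z !mulr1.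
Qed.

Variables e f : 'I_n -> {linear V -> V}.
Hypothesis ef : qfermions q (fun i j : 'I_n => ltn i j) e f.

Lemma wedge_braid I M v : wedge f M (wedge e I v) =
  \sum_(S in exchanges I M)
    braid_coef q I M S *: wedge e S (wedge f (natural I M S) v).
Proof.
case: (ef) => ee ff eC fC _ _ _.
elim/set_min_ind: M v => [|m M mM IHM] v.
  rewrite (big_pred1 I) => [|S]; last first.
    rewrite /= inE setU0 setI0 sub0set /=.
    apply/andP/eqP => [[SI /eqP cS]|->]; last by rewrite subxx eqxx.
    by apply/eqP; rewrite eqEcard SI cS leqnn.
  rewrite braid_coef_id setI0 cards0 expr0 invr1 scale1r enum_set0 /natural.
  by rewrite setI0 setU0 setDv setU0 enum_set0.
have mNM : m \notin M by apply/negP => /mM; rewrite ltnn.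
rewrite (wedge_min ff fC _ mM) IHM linear_sum /=.
pose B S := wedge e S (wedge f (natural I (m |: M) S) v).
pose F S := wedge f (natural I M S) v.
pose sw S i := t ^ ((below S m)%:Z - (below S i)%:Z + (below (I :\: S) i)%:Z).
have keepE S : S \in exchanges I M -> wedge e S (f m (F S)) =
    if (m \in I) ==> (m \in S) then t ^ (below (I :\: S) m)%:Z *: B S else 0.
  move=> /exchangesP[SIM IMS _].
  have nat_m : (m \in natural I M S) = ~~ ((m \in I) ==> (m \in S)).
    by rewrite !inE (negPf mNM) andbF orbF negb_imply andbC.
  rewrite /F (wedge_insert ff fC) nat_m; case: ifPn => [/negPf->|/negbNE mIS].
    by rewrite linear0.
  rewrite mIS linearZ /= /B.
  have -> : m |: natural I M S = natural I (m |: M) S.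
    apply/setP => x; rewrite /natural !inE; case: (eqVneq x m) => [->|//].
    have := SIM m; rewrite inE (negPf mNM) orbF; move: mIS.
    by case: (m \in I); case: (m \in S) => //= _ /(_ isT).
  congr (_ *: _); rewrite -exprnP; congr (_ ^+ _).
  apply: (@eq_below _ _ _ m) => // x; rewrite inE => xm.
  rewrite !inE; have /negPf-> : x \notin M by apply/negP => /mM; rewrite ltnNge ltnW.
  by rewrite andbF orbF.
have swapE S i : S \in exchanges I M -> i \in S -> (i < m)%N ->
    t ^- below S i *: e m (wedge e (S :\ i) (f i (F S))) =
    if m \in S then 0 else sw (m |: S :\ i) i *: B (m |: S :\ i).
  move=> S_ex iS im; have [SIM IMS _] := exchangesP _ _ _ S_ex.
  have iM : i \notin M by apply/negP => /mM; rewrite ltnNge ltnW.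
  have im' : (m == i) = false by rewrite -val_eqE /= gtn_eqF.
  have lt_M x : (x < m)%N -> (x == m) = false /\ (x \in M) = false.
    move=> xm; split; first by rewrite -val_eqE /= ltn_eqF.
    by apply/negP => /mM; rewrite ltnNge ltnW.
  have iF : i \notin natural I M S by rewrite !inE iS (negPf iM) andbF.
  rewrite /F (wedge_insert ff fC) (negPf iF) linearZ /= linearZ /= scalerA.
  rewrite (wedge_insert ee eC) !inE im' /=.
  have [mS|mS] := boolP (m \in S); first by rewrite scaler0.
  have -> : i |: natural I M S = natural I (m |: M) (m |: S :\ i).
    apply/setP => x; rewrite /natural !inE.
    have [->|xi] := eqVneq x i.
      rewrite eq_sym im' /=; have := SIM i iS; rewrite inE (negPf iM) orbF => ->.
      by rewrite orbT.
    have [->|xm] := eqVneq x m; rewrite ?(negPf mNM) ?andbF ?mS //=.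
    by rewrite andbT !orbF.
  rewrite scalerA /B; congr (_ *: _).
  have -> : below (S :\ i) m = below (m |: S :\ i) m.
    by rewrite belowU1 ?ltnn // !inE (negPf mS) andbF.
  have -> : below S i = below (m |: S :\ i) i.
    rewrite belowU1 ?inE ?(negPf mS) ?andbF // (belowD1 _ iS) ltnn.
    by rewrite (leq_gtF (ltnW im)).
  have -> : below (natural I M S) i = below (I :\: (m |: S :\ i)) i.
    apply: (@eq_below _ _ _ i) => // x; rewrite inE => xi.
    have [xm xM] := lt_M _ (ltn_trans xi im).
    have xi' : (x == i) = false by rewrite -val_eqE /= ltn_eqF.
    by rewrite !inE xM xm xi' /= andbF orbF.
  by rewrite /sw !expfzDr // -!exprnP -invr_expz; ring.
have coefE S : S \in exchanges I (m |: M) -> braid_coef q I (m |: M) S =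
    (if (m \in S) ==> (m \in I) then
       (if m \in S then q^-1 else 1) * t ^ (below (I :\: S) m)%:Z
         * braid_coef q I M S else 0)
    + (if m \in S then - qh * \sum_(i in I :\: S | (i < m)%N)
           sw S i * braid_coef q I M (i |: S :\ m) else 0).
  move=> S_ex; have [mS|mS] := boolP (m \in S); last first.
    by rewrite addr0 mul1r braid_coef_notin.
  by rewrite braid_coef_in // mulNr.
transitivity (
  \sum_(S in exchanges I M | (m \in I) ==> (m \in S))
     (if m \in S then q^-1 else 1) * t ^ (below (I :\: S) m)%:Z
       * braid_coef q I M S *: B S
  + \sum_(S in exchanges I M | m \notin S) \sum_(i in S | (i < m)%N)
     - qh * sw (m |: S :\ i) i * braid_coef q I M S *: B (m |: S :\ i)).
  rewrite [X in X + _]big_mkcondr [X in _ + X]big_mkcondr -big_split.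
  apply: eq_bigr => S S_ex /=.
  rewrite linearZ /= (fe_wedge q0 ef) keepE // scalerBr scalerA; congr (_ + _).
    case: (_ ==> _); rewrite ?scaler0 // scalerA.
    by congr (_ *: _); rewrite [RHS]mulrC mulrA.
  rewrite scalerA -scaleNr scaler_sumr.
  rewrite (eq_bigr (fun i => - (braid_coef q I M S * qh) *:
    (if m \in S then 0 else sw (m |: S :\ i) i *: B (m |: S :\ i)))); last first.
    by move=> i /andP[iS im]; congr (_ *: _); exact: swapE.
  case: (m \in S) => /=; first by rewrite big1 // => i _; rewrite scaler0.
  apply: eq_bigr => i _; rewrite scalerA; congr (_ *: _).
  by rewrite mulNr !mulNr; congr (- _); rewrite -[LHS]mulrA mulrC.
rewrite (eq_bigl _ _ (exchanges_keep I mM)).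
under [RHS]eq_bigr => S S_ex do rewrite coefE // scalerDl.
rewrite big_split /=; congr (_ + _).
  by rewrite big_mkcondr; apply: eq_bigr => S _; case: ifP => // _; rewrite scale0r.
transitivity (\sum_(S in exchanges I (m |: M) | m \in S)
    \sum_(i in I :\: S | (i < m)%N)
       - qh * (sw S i * braid_coef q I M (i |: S :\ m)) *: B S); last first.
  rewrite big_mkcondr; apply: eq_bigr => S _; case: ifP => _; last by rewrite scale0r.
  by rewrite -scaler_suml -mulr_sumr.
rewrite !pair_big_dep /=.
rewrite (reindex_onto (fun p : {set 'I_n} * 'I_n => (p.2 |: p.1 :\ m, p.2))
  (fun p => (m |: p.1 :\ p.2, p.2))) /=; last first.
  move=> [S i] /= /andP[/andP[S_ex mS] /andP[iS im]].
  by rewrite setU1K ?setD1K // !inE (negPf mS) andbF.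
apply: eq_big => [[S i]|[S i] /andP[]] /=.
  apply/idP/idP => [/andP[/andP[/andP[S_ex mS] /andP[iS im]] /eqP[SE]]|].
    have := exchanges_swap mM S_ex mS iS im.
    rewrite SE => -[-> iI iNS]; rewrite inE iI iNS im !andbT.
    by rewrite -SE setU11.
  rewrite in_setD => /andP[/andP[S_ex mS] /andP[/andP[iS iI] im]].
  have [-> ->] := exchanges_unswap mM S_ex mS iI iS im.
  rewrite !inE eqxx im setU1K ?setD1K //=.
  by rewrite !inE (negPf iS) andbF.
move=> _ /eqP[SE]; rewrite SE.
by congr (_ *: _); ring.
Qed.

End Straightening.

(** * The coaction and the quantum minors *)

Lemma sum_pairs_lt (V : nmodType) n (F : 'I_n -> 'I_n -> V) :
  \sum_j \sum_m F j m =
  \sum_j F j j + \sum_(p : 'I_n * 'I_n | (p.1 < p.2)%N) (F p.1 p.2 + F p.2 p.1).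
Proof.
rewrite big_split /= addrA.
rewrite [X in _ + _ + X](reindex_onto (fun p : 'I_n * 'I_n => (p.2, p.1))
  (fun p => (p.2, p.1))) /=; last by case.
rewrite [X in _ + _ + X](eq_bigl (fun p : 'I_n * 'I_n => (p.2 < p.1)%N)); last first.
  by case=> a b /=; rewrite eqxx andbT.
rewrite pair_big /= (bigID (fun p => p.1 == p.2)) -addrA; congr (_ + _).
  rewrite (reindex_onto (fun j => (j, j)) fst) /=; last by move=> [a b] /= /eqP->.
  by apply: eq_bigl => j; rewrite !eqxx.
rewrite (bigID (fun p : 'I_n * 'I_n => (p.1 < p.2)%N)) /=.
congr (_ + _); apply: eq_bigl => p.
  by rewrite andb_idl // -val_eqE => /ltn_eqF->.
by rewrite -val_eqE -leqNgt ltn_neqAle eq_sym.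
Qed.

Section Coaction.
Variables (n : nat) (k : fieldType) (q : k).
Hypothesis q0 : q != 0.
Local Notation t := (- q).
Local Notation qh := (q - q^-1).
Local Notation A := (Oq n q).
Local Notation X := (X q).
Variables (V : lmodType k) (act : A -> {linear V -> V}).
Hypothesis act_lin : forall v, linear (act^~ v).
Hypothesis actM : forall a b v, act (a * b) v = act a (act b v).

Definition coact (e : 'I_n -> {linear V -> V}) (i : 'I_n) (v : V) : V :=
  \sum_j act (X i j) (e j v).

Fact coact_linear e i : linear (coact e i).
Proof.
move=> a u v; rewrite /coact scaler_sumr -big_split; apply: eq_bigr => j _ /=.
by rewrite !linearP.
Qed.
HB.instance Definition _ e i :=
  GRing.isLinear.Build k V V *:%R (coact e i) (coact_linear e i).

Lemma act_add a b v : act (a + b) v = act a v + act b v.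
Proof. by have := act_lin v 1 a b; rewrite !scale1r. Qed.

Lemma act_zero v : act 0 v = 0.
Proof. by apply: (@addrI _ (act 0 v)); rewrite -act_add !addr0. Qed.

Lemma act_scale c a v : act (c *: a) v = c *: act a v.
Proof. by have := act_lin v c a 0; rewrite act_zero !addr0. Qed.

Lemma act_sum (T : Type) (r : seq T) (P : pred T) (F : T -> A) v :
  act (\sum_(i <- r | P i) F i) v = \sum_(i <- r | P i) act (F i) v.
Proof. by apply: (big_morph (act^~ v)) => [a b|]; rewrite ?act_zero ?act_add. Qed.

Let act_linZ c a v : act a (c *: v) = c *: act a v.
Proof. by rewrite linearZ. Qed.
Let act_linB a u v : act a (u - v) = act a u - act a v.
Proof. by rewrite linearB. Qed.

Section Two.
Variables e f : 'I_n -> {linear V -> V}.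
Hypothesis e_act : forall i a v, e i (act a v) = act a (e i v).

Lemma coact2 i l v : coact e i (coact f l v) =
  \sum_j \sum_m act (X i j * X l m) (e j (f m v)).
Proof.
rewrite /coact; apply: eq_bigr => j _; rewrite !linear_sum; apply: eq_bigr => m _.
by rewrite /= e_act actM.
Qed.
End Two.

Section Ext.
Variables e : 'I_n -> {linear V -> V}.
Hypothesis e_act : forall i a v, e i (act a v) = act a (e i v).
Hypothesis ee : forall i v, e i (e i v) = 0.
Hypothesis eC : forall (i j : 'I_n) v, (i < j)%N -> e j (e i v) = t *: e i (e j v).

Lemma coact_sq i v : coact e i (coact e i v) = 0.
Proof.
rewrite coact2 // sum_pairs_lt !big1 ?addr0 // => [[j m] jm|j _] /=; last first.
  by rewrite ee linear0.
by rewrite (eC _ jm) act_linZ X_row // act_scale -scalerDl subrr scale0r.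
Qed.

Lemma coactC (i l : 'I_n) v : (i < l)%N ->
  coact e l (coact e i v) = t *: coact e i (coact e l v).
Proof.
move=> il; rewrite !coact2 // !sum_pairs_lt scalerDr; congr (_ + _).
  by rewrite !big1 ?scaler0 // => j _; rewrite ee linear0.
rewrite scaler_sumr; apply: eq_bigr => -[j m] /= jm.
rewrite !(eC _ jm) !act_linZ.
have crossE : X i j * X l m = X l m * X i j + qh *: (X l j * X i m).
  by rewrite -(X_comm q il jm) -X_cross // addrC subrK.
rewrite crossE (X_comm q il jm) act_add !act_scale !scalerDr !scalerA.
rewrite addrC -addrA -scalerDl.
have -> : t * (q - q^-1) + t * t = 1 by field.
by rewrite scale1r.
Qed.
End Ext.

Lemma qfermions_coact (e f : 'I_n -> {linear V -> V}) :
  (forall i a v, e i (act a v) = act a (e i v)) ->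
  (forall i a v, f i (act a v) = act a (f i v)) ->
  qfermions q (fun i j : 'I_n => ltn i j) e f ->
  qfermions q (fun i j : 'I_n => ltn i j) (coact e) (coact f).
Proof.
move=> e_act f_act [ee ff eC fC fe_gt fe_lt fe_eq].
have q1 : q^-1 * q = 1 by rewrite mulVf.
split=> [i v|i v|i j v ij|i j v ij|i l v il|i l v li|i v] /=.
- exact: coact_sq.
- exact: coact_sq.
- exact: coactC.
- exact: coactC.
- rewrite !coact2 // !sum_pairs_lt scalerDr opprD addrACA; congr (_ + _).
    rewrite scaler_sumr -sumrB; apply: eq_bigr => j _.
    rewrite fe_eq act_linZ (X_col q _ il) act_scale -scalerBl; congr (_ *: _); ring.
  rewrite scaler_sumr -sumrB; apply: eq_bigr => -[j m] /= jm.
  rewrite (fe_lt _ _ _ jm) (fe_gt _ _ _ jm) act_linB act_linZ.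
  have crossE : X i j * X l m = X l m * X i j + qh *: (X l j * X i m).
    by rewrite -(X_comm q il jm) -X_cross // addrC subrK.
  rewrite crossE (X_comm q il jm) act_add !act_scale !scalerDr.
  rewrite [_ + _ + act _ _]addrAC opprD [RHS]addrA addrK [LHS]addrA.
  by rewrite [X in X - _ = _]addrC.
- rewrite !coact2 // !sum_pairs_lt; congr (_ + _).
    apply: eq_bigr => j _.
    by rewrite fe_eq act_linZ (X_col q _ li) act_scale scalerA q1 scale1r.
  apply: eq_bigr => -[j m] /= jm.
  rewrite (fe_lt _ _ _ jm) (fe_gt _ _ _ jm) act_linB act_linZ.
  rewrite -(X_comm q li jm).
  have -> : X l j * X i m = X i m * X l j + qh *: (X l m * X i j).
    by rewrite -X_cross // addrC subrK.
  by rewrite act_add act_scale addrACA subrr addr0 addrC.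
rewrite !coact2 // !sum_pairs_lt scalerDr !scaler_sumr; congr (_ + _).
  by apply: eq_bigr => j _; rewrite fe_eq act_linZ.
apply: eq_bigr => -[j m] /= jm.
rewrite (fe_lt _ _ _ jm) (fe_gt _ _ _ jm) act_linB act_linZ (X_row q _ jm).
rewrite !act_scale scalerDr.
rewrite scalerA q1 scale1r addrCA -scalerBl.
by congr (_ + _ *: _); ring.
Qed.
End Coaction.

Section Inversions.
Variable n : nat.

Fixpoint inversions (c : seq 'I_n) : nat :=
  if c is a :: c' then (count (fun x : 'I_n => x < a) c' + inversions c')%N else 0.

Lemma inversionsE d c : inversions c =
  (\sum_(i < size c) \sum_(j < size c) (i < j) && (nth d c j < nth d c i))%N.
Proof.
elim: c => [|a c IHc] /=; first by rewrite big_ord0.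
rewrite big_ord_recl big_ord_recl /= add0n IHc; congr (_ + _)%N.
  rewrite -sum1_count big_mkcond (big_nth d) big_mkord.
  by apply: eq_bigr => i _; case: ifP.
by apply: eq_bigr => i _; rewrite big_ord_recl.
Qed.

Lemma perm_lengthE m (s : 'S_m) :
  perm_length s = (\sum_(i < m) \sum_(j < m) (i < j) && (s j < s i))%N.
Proof.
rewrite pair_big /= /perm_length -sum1_card big_mkcond /=.
by apply: eq_bigr => p _; rewrite inE; case: ifP.
Qed.

Lemma inversions_perm (J : {set 'I_n}) m (c : m.-tuple 'I_n) (s : 'S_m) d :
  #|J| = m -> (forall i, tnth c i = nth d (enum J) (s i)) ->
  inversions c = perm_length s.
Proof.
move=> cardJ cE; rewrite (inversionsE d) perm_lengthE size_tuple.
apply: eq_bigr => i _; apply: eq_bigr => j _; rewrite -!tnth_nth !cE.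
move: s {cE}; case: m / cardJ c i j => c i j s.
by rewrite -!enum_val_nth enum_val_ltn.
Qed.

Lemma below_count_uniq (c : seq 'I_n) a : uniq c ->
  below [set x in c] a = count (fun x : 'I_n => x < a)%N c.
Proof.
move=> uc; rewrite below_count -sum1_count [RHS]big_mkcond /= (big_uniq _ uc) /=.
by apply: eq_big => [x|x _]; rewrite ?inE //; case: ifP.
Qed.
End Inversions.

Section WedgeTuple.
Variables (n : nat) (k : fieldType) (q : k) (V : lmodType k).
Local Notation t := (- q).
Variable e : 'I_n -> {linear V -> V}.
Hypothesis ee : forall i v, e i (e i v) = 0.
Hypothesis eC : forall (i j : 'I_n) v, (i < j)%N -> e j (e i v) = t *: e i (e j v).

Lemma opprod_seq (c : seq 'I_n) v : opprod e c v =
  if uniq c then t ^+ inversions c *: opprod e (enum [set x in c]) v else 0.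
Proof.
elim: c => [|a c IHc]; first by rewrite set_nil enum_set0 scale1r.
rewrite -[LHS]/(e a (opprod e c v)) IHc /= andbC.
case uc: (uniq c) => /=; last by rewrite linear0.
rewrite linearZ /= (wedge_insert ee eC) inE.
case: (a \in c); first by rewrite scaler0.
by rewrite scalerA -exprD addnC (below_count_uniq _ uc) set_cons.
Qed.
End WedgeTuple.

Section Minors.
Variables (n : nat) (k : fieldType) (q : k).
Hypothesis q0 : q != 0.
Local Notation t := (- q).
Local Notation A := (Oq n q).
Local Notation X := (X q).

Lemma qminorE (I J : {set 'I_n}) : #|J| = #|I| -> qminor q I J =
  \sum_(c : #|I|.-tuple 'I_n | uniq c && ([set x in c] == J))
    t ^+ inversions c *: \prod_(p <- zip (enum I) c) X p.1 p.2.
Proof.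
move=> JI.
have eJP : size (enum J) == #|I| by rewrite -cardE JI.
pose eJ := Tuple eJP.
pose h (s : 'S_#|I|) := [tuple tnth eJ (s i) | i < #|I|].
have h_inj : injective h.
  have eJ_inj : injective (tnth eJ) by apply/tuple_uniqP; exact: enum_uniq.
  move=> s1 s2 hE; apply/permP => i; apply: eJ_inj.
  by have := congr1 (fun c => tnth c i) hE; rewrite !tnth_mktuple.
rewrite (eq_bigl (mem (h @: [set: 'S_#|I|]))) => [|c]; last first.
  apply/andP/imsetP => [[uc /eqP cJ]|[s _ ->]].
    have /tuple_permP[s sE] : perm_eq c eJ.
      apply: uniq_perm => //; first exact: enum_uniq.
      by move=> x; rewrite mem_enum -cJ inE.
    by exists s => //; apply: val_inj.
  have ph : perm_eq (h s) eJ by apply/tuple_permP; exists s.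
  rewrite (perm_uniq ph) enum_uniq; split=> //; apply/eqP/setP => x.
  by rewrite inE (perm_mem ph) mem_enum.
rewrite big_imset /=; last by move=> s1 s2 _ _; exact: h_inj.
rewrite /qminor; apply: eq_big => [s|s _]; first by rewrite inE.
have [I0|[d _]] := set_0Vmem I.
  have no_ord (l : 'I_#|I|) : False by case: l => l; rewrite I0 cards0.
  have -> : tval (h s) = [::].
    by apply: size0nil; rewrite size_tuple I0 cards0.
  have -> : perm_length s = 0.
    by rewrite perm_lengthE; apply: big1 => l; have := no_ord l.
  rewrite [in RHS](_ : zip (enum I) [::] = [::]); last by case: (enum I).
  rewrite big_nil; congr (_ *: _); apply: big1 => l; by have := no_ord l.
rewrite (@inversions_perm _ J _ (h s) s d) //; last first.
  by move=> i; rewrite tnth_mktuple (tnth_nth d).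
congr (_ *: _).
have szE : size (enum I) = size (h s) by rewrite size_tuple -cardE.
rewrite (big_nth (d, d)) size_zip szE size_tuple minnn big_mkord.
apply: eq_bigr => l _; rewrite nth_zip //=.
rewrite -enum_val_nth; congr (X _ _).
by rewrite (nth_map l) ?size_enum_ord // nth_ord_enum (tnth_nth (enum_val l)).
Qed.

Variables (V : lmodType k) (act : A -> {linear V -> V}).
Hypothesis act_lin : forall v, linear (act^~ v).
Hypothesis actM : forall a b v, act (a * b) v = act a (act b v).
Hypothesis act1 : forall v, act 1 v = v.
Variable e : 'I_n -> {linear V -> V}.
Hypothesis e_act : forall i a v, e i (act a v) = act a (e i v).
Hypothesis ee : forall i v, e i (e i v) = 0.
Hypothesis eC : forall (i j : 'I_n) v, (i < j)%N -> e j (e i v) = t *: e i (e j v).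

Lemma opprod_act s a v : opprod e s (act a v) = act a (opprod e s v).
Proof.
by elim: s => // i s IHs; rewrite /opprod /= -!/(opprod _ _ _) IHs e_act.
Qed.

Lemma opprod_coact m s v : size s = m -> opprod (coact act e) s v =
  \sum_(c : m.-tuple 'I_n)
    act (\prod_(p <- zip s c) X p.1 p.2) (opprod e c v).
Proof.
elim: s m => [|i s IHs] m /= <-.
  rewrite (big_pred1 [tuple]) => [|c]; last by apply/esym/eqP; exact: tuple0.
  by rewrite big_nil act1.
rewrite -[LHS]/(coact act e i (opprod (coact act e) s v)) (IHs (size s)) //.
rewrite /coact.
rewrite (reindex (fun p : 'I_n * (size s).-tuple 'I_n => cons_tuple p.1 p.2)) /=;
  last first.
  exists (fun c => (thead c, behead_tuple c)) => [[x c] _|c _].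
    by congr (_, _); apply: val_inj.
  by apply: val_inj; rewrite /= [in RHS](tuple_eta c).
rewrite -(pair_bigA _ (fun j (c : (size s).-tuple 'I_n) =>
  act (\prod_(p <- (i, j) :: zip s c) X p.1 p.2) (opprod e (j :: c) v))) /=.
apply: eq_bigr => j _; rewrite !linear_sum; apply: eq_bigr => c _.
by rewrite /= big_cons actM e_act.
Qed.

Lemma coact_wedge (I : {set 'I_n}) v : opprod (coact act e) (enum I) v =
  \sum_(J : {set 'I_n} | #|J| == #|I|)
    act (qminor q I J) (opprod e (enum J) v).
Proof.
rewrite (opprod_coact _ (esym (cardE I))).
under eq_bigr => c _ do rewrite (opprod_seq ee eC).
rewrite (bigID (fun c : #|I|.-tuple 'I_n => uniq c)) /= addrC big1 ?add0r; last first.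
  by move=> c /negPf->; rewrite linear0.
rewrite (partition_big (fun c : #|I|.-tuple 'I_n => [set x in c])
   (fun J : {set 'I_n} => #|J| == #|I|)) /=; last first.
  move=> c uc; rewrite cardsE; have /card_uniqP-> := uc.
  by rewrite size_tuple.
apply: eq_bigr => J /eqP JI; rewrite (qminorE JI) (act_sum act_lin).
apply: eq_bigr => c /andP[uc /eqP cJ]; rewrite uc cJ linearZ /=.
by rewrite (act_scale act_lin).
Qed.
End Minors.

(** * Comparison of coefficients *)

Section Naturals.
Variable n : nat.
Implicit Types A B S : {set 'I_n}.

Lemma natural_id A B : natural A B A = B.
Proof.
by apply/setP => x; rewrite !inE; case: (x \in A); rewrite ?orbF.
Qed.

Lemma natural_capcup A B S : S \in exchanges A B ->
  S :&: natural A B S = A :&: B /\ S :|: natural A B S = A :|: B.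
Proof.
case/exchangesP=> SAB ABS _; split; apply/setP => x; rewrite !inE.
  have := ABS x; case: (x \in A) (x \in B) (x \in S) => [] [] [] //=.
  by move/(_ isT isT).
have := SAB x; rewrite inE.
by case: (x \in A) (x \in B) (x \in S) => [] [] [] //= /(_ isT).
Qed.

Lemma natural_sym A B S : S \in exchanges A B ->
  A \in exchanges S (natural A B S) /\ natural S (natural A B S) A = B.
Proof.
move=> SAB; have [cap cup] := natural_capcup SAB; split; last first.
  by rewrite /natural -/(natural A B S) cap cup -/(natural A B A) natural_id.
rewrite inE cap cup subsetIl subsetUl /=.
by have [_ _ ->] := exchangesP _ _ _ SAB.
Qed.

Lemma card_natural A B S : S \in exchanges A B -> #|natural A B S| = #|B|.
Proof.
move=> SAB; have [cap cup] := natural_capcup SAB; have [_ _ cS] := exchangesP _ _ _ SAB.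
have := cardsUI S (natural A B S); rewrite cap cup cardsUI cS.
by move/addnI.
Qed.

Lemma exchanges_id A B : A \in exchanges A B.
Proof. by rewrite inE subsetUl subsetIl /=. Qed.

Lemma gt_familyE A B : gt_family A B =
  [set S in exchanges A B | set_le A S && (A != S)].
Proof. by apply/setP => S; rewrite !inE /set_lt -!andbA. Qed.

Lemma lt_familyE A B : lt_family A B =
  [set S in exchanges A B | set_le S A && (S != A)].
Proof. by apply/setP => S; rewrite !inE /set_lt -!andbA. Qed.

End Naturals.

Section Main.
Variables (n : nat) (k : fieldType) (q : k).
Hypothesis q0 : q != 0.
Implicit Types (I J M N S T : {set 'I_n}).

Lemma sum_gt_family (V : lmodType k) I M (F : {set 'I_n} -> V) :
  \sum_(S in exchanges I M) mu_tilde q I M S *: F S =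
  F I + \sum_(S in gt_family I M) mu_tilde q I M S *: F S.
Proof.
rewrite (bigD1 I) ?exchanges_id //=.
have -> : mu_tilde q I M I = 1.
  have := braid_coef_id q I M; rewrite /braid_coef -[RHS]mulr1.
  by apply: mulfI; rewrite invr_eq0 expf_neq0.
rewrite scale1r; congr (_ + _); rewrite gt_familyE.
rewrite (bigID (set_le I)) /= [X in _ + X]big1 ?addr0 => [|S].
  by apply: eq_bigl => S; rewrite !inE -!andbA [(S == I)]eq_sym [set_le _ _ && _]andbC.
case/andP=> /andP[/exchangesP[_ _ cS] _] SI.
rewrite /mu_tilde; suff -> : xi q (S :\: I) (I :\: S) = 0 by rewrite mulr0 scale0r.
by apply: contraNeq SI; exact: xi_set_le.
Qed.

Lemma lambda_muE J N T : T \in exchanges J N ->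
  lambda_tilde q J N T = mu_tilde q T (natural J N T) J.
Proof.
move=> TJN; rewrite /lambda_tilde /mu_tilde /calL /calLnat.
by have [_ ->] := natural_sym TJN; rewrite [_ :|: (T :\: _)]setUC.
Qed.

Lemma sum_lt_family (V : lmodType k) J N (F : {set 'I_n} -> V) :
  \sum_(T in exchanges J N) lambda_tilde q J N T *: F T =
  F J + \sum_(T in lt_family J N) lambda_tilde q J N T *: F T.
Proof.
rewrite (bigD1 J) ?exchanges_id //=.
have -> : lambda_tilde q J N J = 1.
  rewrite lambda_muE ?exchanges_id // natural_id.
  have := braid_coef_id q J N; rewrite /braid_coef -[RHS]mulr1.
  by apply: mulfI; rewrite invr_eq0 expf_neq0.
rewrite scale1r; congr (_ + _); rewrite lt_familyE.
rewrite (bigID (fun T => set_le T J)) /= [X in _ + X]big1 ?addr0 => [|T].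
  by apply: eq_bigl => T; rewrite !inE -!andbA [set_le _ _ && _]andbC.
case/andP=> /andP[/exchangesP[_ _ cT] _] TJ.
rewrite /lambda_tilde; suff -> : xi q (J :\: T) (T :\: J) = 0 by rewrite mulr0 scale0r.
by apply: contraNeq TJ; exact: xi_set_le.
Qed.

Lemma minor_braiding I J M N : #|I| = #|J| -> #|M| = #|N| ->
  \sum_(S in exchanges I M)
    braid_coef q I M S *: (qminor q S J * qminor q (natural I M S) N)
  = \sum_(T in exchanges J N)
    braid_coef q T (natural J N T) J *: (qminor q M (natural J N T) * qminor q I T).
Proof.
move=> IJ MN.
have [V e' f' act vac coef ferm act_lin act1 actM e_act f_act coef_act coef_vac] :=
  qfock_exists q0 (Oq n q) n.
pose e (i : 'I_n) : {linear V -> V} := e' i.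
pose f (i : 'I_n) : {linear V -> V} := f' i.
have ef : qfermions q (fun i j : 'I_n => ltn i j) e f.
  case: ferm => ee ff eC fC fe_gt fe_lt fe_eq.
  by split=> [i v|i v|i j v|i j v|i j v|i j v|i v]; rewrite /e /f; auto.
have hef : qfermions q (fun i j : 'I_n => ltn i j) (coact act e) (coact act f).
  by apply: qfermions_coact => // [i a v|i a v]; [exact: e_act | exact: f_act].
have [ee ff eC fC _ _ _] := ef.
pose c (S : {set 'I_n}) : pred nat := fun i => i \in [seq val x | x <- enum S].
have wedgeE (g : nat -> {linear V -> V}) S v :
    opprod (fun i : 'I_n => g i) (enum S) v = opprod g [seq i <- iota 0 n | c S i] v.
  have -> : [seq i <- iota 0 n | c S i] = [seq val x | x <- enum S].
    rewrite -val_enum_ord filter_map; congr map; rewrite [RHS]/enum_mem -enumT.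
    apply: eq_filter => x /=; rewrite /c mem_map ?mem_enum //; exact: val_inj.
  elim: (enum S) => //= x s IHs; by rewrite /opprod /= -!/(opprod _ _ _) IHs.
have c_inj S T : all (fun i => c S i == c T i) (iota 0 n) = (T == S).
  apply/allP/eqP => [cE|-> i _]; last exact: eqxx.
  apply/setP => x; have xn : val x \in iota 0 n by rewrite mem_iota ltn_ord.
  have := cE _ xn; rewrite /c !(mem_map val_inj) !mem_enum => /eqP->.
  by [].
have coefE S T (a : Oq n q) :
    coef (c J) (c N) (act a (opprod e (enum S) (opprod f (enum T) vac)))
    = if (S == J) && (T == N) then a else 0.
  rewrite coef_act !wedgeE coef_vac (all_predI (fun i => c J i == c S i)) !c_inj.
  by case: ifP => _; rewrite ?mulr1 ?mulr0.
have eM := opprod_act e_act; have fM := opprod_act f_act.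
have eW := coact_wedge act_lin actM act1 e_act ee eC.
have fW := coact_wedge act_lin actM act1 f_act ff fC.
have := congr1 (coef (c J) (c N)) (wedge_braid q0 hef I M vac).
have -> : opprod (coact act f) (enum M) (opprod (coact act e) (enum I) vac) =
  \sum_(T' : {set 'I_n} | #|T'| == #|M|) \sum_(T : {set 'I_n} | #|T| == #|I|)
    \sum_(S in exchanges T T')
      act (braid_coef q T T' S *: (qminor q M T' * qminor q I T))
        (opprod e (enum S) (opprod f (enum (natural T T' S)) vac)).
  rewrite fW eW; apply: eq_bigr => T' _; rewrite !linear_sum; apply: eq_bigr => T _ /=.
  rewrite fM -actM (wedge_braid q0 ef) linear_sum; apply: eq_bigr => S _ /=.
  by rewrite linearZ /= (act_scale act_lin).
rewrite !linear_sum /= => coefLR; symmetry; symmetry in coefLR.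
transitivity (\sum_(S in exchanges I M) coef (c J) (c N) (braid_coef q I M S *:
   opprod (coact act e) (enum S) (opprod (coact act f) (enum (natural I M S)) vac))).
  rewrite coefLR.
  pose G T T' := braid_coef q T T' J *: (qminor q M T' * qminor q I T).
  have swap_cond T T' : (J \in exchanges T T') && (natural T T' J == N) =
      (T \in exchanges J N) && (T' == natural J N T).
    apply/andP/andP => [[JTT' /eqP <-]|[TJN /eqP->]].
      by have [-> ->] := natural_sym JTT'.
    by have [-> ->] := natural_sym TJN.
  have innerE T T' : \sum_(S in exchanges T T')
      (if (S == J) && (natural T T' S == N) then G T T' else 0) =
      if (T \in exchanges J N) && (T' == natural J N T) then G T T' else 0.
    rewrite -swap_cond -big_mkcondr /=; have [JTT'|JTT'] := boolP (J \in exchanges T T').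
      case: eqP => [nJ|nJ] /=.
        rewrite (big_pred1 J) // => S /=; apply/idP/eqP => [/and3P[_ /eqP]//|->].
        by rewrite JTT' nJ !eqxx.
      by rewrite big_pred0 // => S; apply/negP => /and3P[_ /eqP-> /eqP].
    rewrite big_pred0 // => S; apply/negP => /and3P[STT' /eqP SJ].
    by rewrite SJ (negPf JTT') in STT'.
  transitivity (\sum_(T' : {set 'I_n} | #|T'| == #|M|)
      \sum_(T : {set 'I_n} | #|T| == #|I|)
     if (T \in exchanges J N) && (T' == natural J N T) then G T T' else 0); last first.
    apply: eq_bigr => T' _; rewrite linear_sum; apply: eq_bigr => T _ /=.
    rewrite linear_sum -innerE; apply: eq_bigr => S _ /=; rewrite coefE.
    by case: eqP => [->|].
  rewrite exchange_big /= [LHS]big_mkcond [RHS]big_mkcond; apply: eq_bigr => T _.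
  case: (boolP (T \in exchanges J N)) => [TJN|_] /=; last first.
    by rewrite big1 ?if_same.
  have [_ _ cT] := exchangesP _ _ _ TJN.
  rewrite cT IJ eqxx (bigD1 (natural J N T)) /= ?(card_natural TJN) ?MN // eqxx.
  by rewrite big1 ?addr0 // => T' /andP[_ /negPf->].
apply: eq_bigr => S SIM; rewrite linearZ /=; congr (_ *: _).
have SJ : #|J| = #|S| by have [_ _ ->] := exchangesP _ _ _ SIM.
have SN : #|N| = #|natural I M S| by rewrite (card_natural SIM).
rewrite eW linear_sum (bigD1 J) ?SJ //= big1 => [|J' /andP[_ J'J]]; last first.
  rewrite fW !linear_sum big1 // => N' _ /=.
  by rewrite eM -actM coefE (negPf J'J).
rewrite addr0 fW !linear_sum (bigD1 N) ?SN //= big1 => [|N' /andP[_ N'N]]; last first.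
  by rewrite eM -actM coefE (negPf N'N) andbF.
by rewrite eM -actM coefE !eqxx addr0.
Qed.

End Main.

Theorem theorem5p7 (k : fieldType) (n : nat) (q : k) (I J M N : {set 'I_n}) :
  (0 < n)%N -> q != 0 -> #|I| = #|J| -> #|M| = #|N| ->
  q ^+ #|J :&: N| *: (qminor q I J * qminor q M N)
  + q ^+ #|J :&: N| *:
      (\sum_(S in gt_family I M)
          mu_tilde q I M S *: (qminor q S J * qminor q (natural I M S) N))
  = q ^+ #|I :&: M| *: (qminor q M N * qminor q I J)
    + q ^+ #|I :&: M| *:
        (\sum_(T in lt_family J N)
            lambda_tilde q J N T *:
              (qminor q M (natural J N T) * qminor q I T)).
Proof.
move=> _ q0 IJ MN.
have := sum_gt_family q0 I M (fun S => qminor q S J * qminor q (natural I M S) N).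
have := sum_lt_family q0 J N (fun T => qminor q M (natural J N T) * qminor q I T).
rewrite !natural_id -!scalerDr => <- <-.
have := minor_braiding q0 IJ MN.
under eq_bigr do rewrite -scalerA.
rewrite -scaler_sumr.
rewrite [RHS](eq_bigr (fun T => q ^- #|J :&: N| *: (lambda_tilde q J N T *:
   (qminor q M (natural J N T) * qminor q I T)))) => [|T TJN]; last first.
  by rewrite scalerA lambda_muE // /braid_coef; have [-> _] := natural_capcup TJN.
rewrite -scaler_sumr => /(congr1 (fun u => (q ^+ #|I :&: M| * q ^+ #|J :&: N|) *: u)).
by rewrite !scalerA mulrAC divff ?expf_neq0 // mul1r mulfK ?expf_neq0.
Qed.
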